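(* For every $\varepsilon>0$ there exists $p_0(\varepsilon)$ such that for every prime $p \ge p_0(\varepsilon)$, every real $U \ge p^{\frac12 e^{-1/2}+\varepsilon}$ and every integer $a$ with $\gcd(a,p)=1$ there exist integers $u_1,\ldots,u_9$ with $$q_p(u_1)+\cdots+q_p(u_9)\equiv a \pmod p, \qquad 1\le u_1,\ldots,u_9\le U,$$ where $q_p$ is the Fermat quotient modulo $p$.
   Context: For a prime $p$ and an integer $u$ with $\gcd(u,p)=1$, the Fermat quotient $q_p(u)$ is the unique integer with $q_p(u)\equiv \frac{u^{p-1}-1}{p} \pmod p$ and $0\le q_p(u)\le p-1$. For integers divisible by $p$ one sets $q_p(kp)=0$, $k\in\mathbb{Z}$. *)

(* Defs.v *)
From mathcomp Require Import all_boot all_order all_algebra.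
From mathcomp Require cyclic.

Set Implicit Arguments.
Unset Strict Implicit.
Unset Printing Implicit Defensive.

Import Order.TTheory GRing.Theory Num.Theory.

Local Open Scope ring_scope.

(* For p prime and u coprime to p, the division by p is exact by Fermat's
   little theorem, and %% takes values in [0, p - 1] even when u < 0; see
   fermat_quotientP and fermat_quotient_uniq. *)
Definition fermat_quotient (p : nat) (u : int) : int :=
  if coprimez u p then (((u ^+ p.-1 - 1) %/ p)%Z %% p)%Z else 0.

Lemma dvdz_fermat (p : nat) (u : int) :
  prime p -> coprimez u p -> (p %| (u ^+ p.-1 - 1)%R)%Z.
Proof.
move=> p_pr cup; rewrite -eqz_mod_dvd -modzXm; apply/eqP.
have p0 : p%:Z != 0 by rewrite -lt0n prime_gt0.
have : coprimez (u %% p)%Z p.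
  by move: cup; rewrite /coprimez gcdz_modl.
case: (u %% p)%Z (modz_ge0 u p0) => // m _ cmp.
have := cyclic.Euler_exp_totient (cmp : coprime m p).
rewrite totient_prime // => h.
by rewrite -[_ ^+ _]/(Posz m ^+ p.-1) -rmorphXn /= -[1]/(1%:Z) !modz_nat natrXE h.
Qed.

Lemma fermat_quotientP (p : nat) (u : int) : prime p -> coprimez u p ->
  [/\ (fermat_quotient p u = ((u ^+ p.-1 - 1) %/ p)%Z %[mod p])%Z,
      ((u ^+ p.-1 - 1) %/ p)%Z * p = u ^+ p.-1 - 1
    & 0 <= fermat_quotient p u <= p%:Z - 1].
Proof.
move=> p_pr cup; rewrite /fermat_quotient cup; split.
- by rewrite modz_mod.
- by apply: divzK; apply: dvdz_fermat.
- have p0 : p%:Z != 0 by rewrite -lt0n prime_gt0.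
  by rewrite modz_ge0 //= -ltzD1 subrK ltz_pmod // ltz_nat prime_gt0.
Qed.

Lemma fermat_quotient_uniq (p : nat) (u q : int) : coprimez u p ->
  (q = ((u ^+ p.-1 - 1) %/ p)%Z %[mod p])%Z -> 0 <= q <= p%:Z - 1 ->
  q = fermat_quotient p u.
Proof.
move=> cup qE /andP[q0 qp]; rewrite /fermat_quotient cup -qE modz_small //.
by rewrite q0 -(subrK 1 p%:Z) ltzD1.
Qed.

Lemma fermat_quotient_mul (p : nat) (k : int) :
  prime p -> fermat_quotient p (k * p) = 0.
Proof.
move=> p_pr; rewrite /fermat_quotient ifF //; apply/negbTE.
rewrite /coprimez /gcdz abszM gcdnC gcdnMl.
by case: p p_pr => [|[|p]].
Qed.

(* Main.v *)
(** For c in F_p put chi_c(x) = e(c q_p(x) / p), a character modulo p^2. Since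
    q_p(x + p k) = q_p(x) - k / x, complete sums of products of shifts of chi_c
    reduce to counting roots of sums of simple fractions, so Burgess' method gives
    a power saving for the sum of chi_c over n <= N as soon as N is slightly larger
    than p^(1/2). For U > N^(e^(-1/2)) Mertens' theorem shows that fewer than half
    of the n <= N have a prime factor exceeding U (Vinogradov's trick). Count the
    solutions of q_p(n1) + q_p(n2) + q_p(s) = a, where n1, n2 <= N and s is a product
    of about p^(5/3) tiny primes: discarding the solutions with n1 rough, and those
    with n2 rough, leaves a positive main term. The error term is the Burgess saving
    times the sum over c of |Y(c)| |S(c)|^m, with Y a sum over n <= N and S a sum over
    tiny primes; Hoelder's inequality reduces it to the sixth moment of Y, where
    pairs x, y <= p^(3/2) with q_p(x) = q_p(y) are counted as lattice points, and to
    the moment of S of total length p, where coprime pairs x, y < p with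
    q_p(x) = q_p(y) are determined by x / y modulo p. A U-smooth n <= N is a product
    of three integers <= U, and the tiny primes can be distributed over nine factors
    <= U because 9 e^(-1/2) / 2 > 2 (1/2) + 5/3. *)

Require Import Defs.
From mathcomp Require Import all_boot all_order all_algebra.
From mathcomp Require Import reals sequences exp.
From mathcomp Require Import all_field.
From mathcomp Require Import zify ring lra.

Set Implicit Arguments.
Unset Strict Implicit.
Unset Printing Implicit Defensive.

Import Order.TTheory GRing.Theory Num.Theory.

Local Open Scope ring_scope.

(** * Divisors and factorisations into small parts *)

(** The lengths are forced by the two moments. Products of L = 6l tiny primes stay below p, the
    range in which a fraction modulo p with equal Fermat quotients determines its coprime terms;
    products of three integers up to N reach p^(3/2), the point from which the lattice count has its
    expected order. At these lengths both moments have the order of their c = 0 terms, up to powers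
    of D. Hoelder's inequality with exponents 6 and 6/5 pairs the sixth moment of Y with the moment
    of S of order 6m/5; equating this with 2L gives m = 10l, the origin of p^(5/3). As only p^o(1)
    is lost elsewhere, an arbitrarily small power saving is enough, so Burgess' bound is used with a
    very large r. The smoothness of n1 and n2 is detected by a sign on n1 alone: the sum over n2
    must stay unweighted for Burgess' method to apply. All sizes are integer powers of z and all
    moment inequalities are raised to integer powers. The character sums can therefore live in
    [algC], and real powers of p enter only at the very end. *)

Lemma leq_exp2r_w (a b k : nat) : (a <= b)%N -> (a ^ k <= b ^ k)%N.
Proof. by case: k => // k; rewrite leq_exp2r. Qed.

(** The left side is at most the falling factorial [(e + k) ^_ k], that is k! times a binomial
    coefficient bounded by [2 ^ (e + k)]. *)
Lemma leq_exp_pow2 (k e : nat) : (e.+1 ^ k <= k`! * 2 ^ k * 2 ^ e)%N.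
Proof.
have ffact_ge m j : (m.+1 ^ j <= (m + j) ^_ j)%N.
  elim: j => [|j IHj]; first by rewrite ffactn0.
  rewrite addnS ffactSS expnS leq_mul // ltnS leq_addr //.
apply: leq_trans (ffact_ge e k) _.
have bin_le s j : ('C(s, j) <= 2 ^ s)%N.
  elim: s j => [|s IHs] [|j]; rewrite ?bin0 ?expn_gt0 //.
  by rewrite binS expnS mul2n -addnn leq_add.
rewrite -bin_ffact mulnC -mulnA leq_mul2l -expnD; apply/orP; right.
by rewrite addnC.
Qed.

Lemma size_divisors_coprime_mul (q e m : nat) : prime q -> (0 < m)%N ->
  (size (divisors (q ^ e * m)) <= e.+1 * size (divisors m))%N.
Proof.
move=> q_pr m_gt0.
have q_gt0 := prime_gt0 q_pr.
pose s := [seq (q ^ i * d)%N | i <- iota 0 e.+1, d <- divisors m].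
have -> : (e.+1 * size (divisors m) = size s)%N by rewrite size_allpairs size_iota.
apply: uniq_leq_size (divisors_uniq _) _ => d.
rewrite -dvdn_divisors ?muln_gt0 ?expn_gt0 ?q_gt0 // => d_dvd.
have d_gt0 : (0 < d)%N by apply: dvdn_gt0 d_dvd; rewrite muln_gt0 expn_gt0 q_gt0.
have [/= j ndvd dE] := pfactor_coprime q_pr d_gt0.
rewrite dE mulnC.
have jm : (j %| m)%N.
  have : (j %| q ^ e * m)%N by apply: dvdn_trans d_dvd; rewrite dE dvdn_mulr.
  by rewrite Gauss_dvdr // coprimeXr // coprime_sym.
case: (leqP (logn q d) e) => [le_e|lt_e].
  by apply/allpairsP; exists (logn q d, j); split;
     [rewrite mem_iota | rewrite -dvdn_divisors | ].
(* the exponent of q exceeds e, so its surplus divides m *)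
have surplus : (q ^ (logn q d - e) * j %| m)%N.
  rewrite -(@dvdn_pmul2l (q ^ e)) ?expn_gt0 ?q_gt0 //.
  by rewrite mulnA -expnD subnKC 1?ltnW // mulnC -dE.
apply/allpairsP; exists (e, (q ^ (logn q d - e) * j)%N); split.
- by rewrite mem_iota /= add0n ltnS.
- by rewrite -dvdn_divisors.
- by rewrite mulnA -expnD subnKC // ltnW.
Qed.

(** A prime power q^e with [2 ^ k <= q] costs no constant, since (e + 1)^k <= 2^(ke) <= q^e; each
    smaller prime costs k! 2^k by [leq_exp_pow2]. The induction on [j] admits the small primes one
    at a time. *)
Lemma divisor_bound (k : nat) : exists C : nat, forall n : nat, (0 < n)%N ->
  (size (divisors n) ^ k <= C * n)%N.
Proof.
suff key j : exists C : nat, forall n : nat, (0 < n)%N ->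
    (forall q, prime q -> q %| n -> (q < j) || (2 ^ k <= q))%N ->
    (size (divisors n) ^ k <= C * n)%N.
  have [C HC] := key (2 ^ k)%N; exists C => n n_gt0; apply: HC => // q _ _.
  by case: ltnP.
elim: j => [|j [C HC]].
  exists 1%N => n; have [m] := ubnP n; elim: m n => // m IHm n lt_nm n_gt0 Hq.
  case: (leqP n 1) => [n_le1|n_gt1].
    have -> : n = 1%N by apply/eqP; rewrite eqn_leq n_le1.
    by rewrite exp1n.
  set q := pdiv n; have q_pr : prime q by apply: pdiv_prime.
  have [/= r ndvd nE] := pfactor_coprime q_pr n_gt0.
  set e := logn q n in nE.
  have e_gt0 : (0 < e)%N by rewrite /e logn_gt0 mem_primes q_pr n_gt0 pdiv_dvd.
  have r_gt0 : (0 < r)%N by move: n_gt0; rewrite nE muln_gt0 => /andP[].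
  have lt_rn : (r < n)%N.
    by rewrite nE ltn_Pmulr // -(exp1n e) ltn_exp2r // prime_gt1.
  rewrite mul1n {1}nE mulnC.
  apply: leq_trans (_ : (e.+1 * size (divisors r)) ^ k <= _)%N.
    by rewrite leq_exp2r_w ?size_divisors_coprime_mul.
  rewrite nE expnMn [leqRHS]mulnC leq_mul //.
    apply: leq_trans (_ : (2 ^ k) ^ e <= _)%N.
      by rewrite -expnM (mulnC k) expnM; apply: leq_exp2r_w; apply: ltn_expl.
    by rewrite leq_exp2r //; move: (Hq q q_pr (pdiv_dvd n)).
  rewrite -[leqRHS]mul1n; apply: IHm => //; first exact: leq_trans lt_rn _.
  by move=> q' pr' dvd'; apply: Hq => //; rewrite nE dvdn_mulr.
case: (boolP (prime j)) => [j_pr|j_npr]; last first.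
  exists C => n n_gt0 Hq; apply: HC => // q q_pr q_dvd.
  have := Hq q q_pr q_dvd; rewrite ltnS leq_eqVlt => /orP[/orP[/eqP qj|->//]|->].
    by rewrite -qj q_pr in j_npr.
  by rewrite orbT.
exists (k`! * 2 ^ k * C)%N => n n_gt0 Hq.
have [/= r ndvd nE] := pfactor_coprime j_pr n_gt0.
set e := logn j n in nE.
have r_gt0 : (0 < r)%N by move: n_gt0; rewrite nE muln_gt0 => /andP[].
rewrite {1}nE mulnC.
apply: leq_trans (_ : (e.+1 * size (divisors r)) ^ k <= _)%N.
  by rewrite leq_exp2r_w ?size_divisors_coprime_mul.
have le1 := leq_exp_pow2 k e.
have le2 : (2 ^ e <= j ^ e)%N by rewrite leq_exp2r_w ?prime_gt1.
have le3 : (size (divisors r) ^ k <= C * r)%N.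
  apply: HC => // q q_pr q_dvd.
  have := Hq q q_pr; rewrite {1}nE dvdn_mulr // => /(_ isT).
  rewrite ltnS leq_eqVlt => /orP[/orP[/eqP qj|->//]|->]; last by rewrite orbT.
  by move: ndvd; rewrite prime_coprime // -qj q_dvd.
rewrite expnMn nE.
have := leq_mul (leq_trans le1 (leq_mul (leqnn _) le2)) le3.
by move/leq_trans; apply; rewrite -!mulnA leq_mul2l leq_mul2l; nia.
Qed.

(** Start from the prime factors and merge. Among four remaining factors a, b, c, d the products ab
    and cd cannot both exceed U, as n <= U^2; so merging is possible until three factors remain. *)
Lemma smooth_prod3 (U n : nat) : (1 < U)%N -> (0 < n)%N -> (n <= U ^ 2)%N ->
  (forall q, prime q -> q %| n -> q <= U)%N ->
  exists x y z : nat, n = (x * y * z)%N /\ (x <= U /\ y <= U /\ z <= U)%N.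
Proof.
move=> U_gt1 n_gt0 n_le n_sm.
have merge k (s : seq nat) : (size s <= k)%N ->
    all (fun x => x <= U)%N s -> (0 < \prod_(x <- s) x <= U ^ 2)%N ->
    exists x y z : nat, (\prod_(t <- s) t = (x * y * z) /\
      (x <= U /\ y <= U /\ z <= U))%N.
  elim: k s => [|k IHk] s.
    rewrite leqn0 size_eq0 => /eqP-> _ _; exists 1%N, 1%N, 1%N.
    by rewrite big_nil; lia.
  have U1 := ltnW U_gt1.
  case: s => [|a [|b [|c [|d s]]]] /=.
  - by exists 1%N, 1%N, 1%N; rewrite big_nil; lia.
  - by move=> _ ? _; exists a, 1%N, 1%N; rewrite big_seq1; lia.
  - by move=> _ ? _; exists a, b, 1%N; rewrite !big_cons big_nil; lia.
  - by move=> _ ? _; exists a, b, c; rewrite !big_cons big_nil; lia.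
  rewrite ltnS => s_size /and5P[aU bU cU dU sU]; rewrite !big_cons => /andP[P_gt0 P_le].
  set P := (\prod_(x <- s) x)%N in P_gt0 P_le *.
  have := P_gt0; rewrite !muln_gt0 => /and5P[a0 b0 c0 d0 P0].
  case: (leqP (a * b) U) => ab.
    have [|||x [y [z [E b3]]]] := IHk [:: (a * b)%N, c, d & s].
    - by [].
    - by rewrite /= ab cU dU.
    - by rewrite !big_cons -/P; apply/andP; split; rewrite ?muln_gt0 ?a0 ?b0 ?c0 ?d0 //; move: P_le; rewrite !mulnA.
    by exists x, y, z; split=> //; rewrite -E !big_cons -/P !mulnA.
  case: (leqP (c * d) U) => cd.
    have [|||x [y [z [E b3]]]] := IHk [:: (c * d)%N, a, b & s].
    - by [].
    - by rewrite /= aU bU cd.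
    - rewrite !big_cons -/P; apply/andP; split; rewrite ?muln_gt0 ?a0 ?b0 ?c0 ?d0 //.
      by apply: leq_trans P_le; rewrite !mulnA; nia.
    by exists x, y, z; split=> //; rewrite -E !big_cons -/P !mulnA; nia.
  have := leq_mul ab cd.
  have : (a * b * (c * d) <= U ^ 2)%N.
    by apply: leq_trans P_le; rewrite !mulnA leq_pmulr.
  by rewrite expnS expn1; nia.
pose s := flatten [seq nseq f.2 f.1 | f <- prime_decomp n].
have sE : (\prod_(x <- s) x = n)%N.
  rewrite [RHS]prod_prime_decomp // /s big_flatten big_map; apply: eq_bigr => f _.
  by rewrite big_nseq iter_muln_1.
have sU : all (fun x => x <= U)%N s.
  apply/allP => x /flattenP[t /mapP[[q e] /mem_prime_decomp[q_pr e_gt0 q_dvd] ->] /nseqP[-> _]] /=.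
  by apply: n_sm => //; apply: dvdn_trans q_dvd; apply: dvdn_exp.
have [|x [y [z [E b3]]]] := merge _ s (leqnn _) sU; first by rewrite sE n_gt0.
by exists x, y, z; rewrite -E sE.
Qed.

(** Greedy filling: an item, being at most [z], may go into any bin of content at most [V]. Such a
    bin exists, for otherwise the bins alone would have product above [V ^ k]. *)
Lemma fill_bins (k V z : nat) (b s : seq nat) :
  (0 < k)%N -> size b = k -> all (fun x => 0 < x <= V * z)%N b ->
  all (fun x => 0 < x <= z)%N s ->
  (\prod_(x <- b) x * \prod_(x <- s) x <= V ^ k)%N ->
  exists c : seq nat, [/\ size c = k, all (fun x => 0 < x <= V * z)%N c &
    (\prod_(x <- c) x = \prod_(x <- b) x * \prod_(x <- s) x)%N].
Proof.
move=> k_gt0; elim: s b => [|t s IHs] b bk bV sz le_V.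
  by exists b; rewrite big_nil muln1.
move: sz => /= /andP[/andP[t0 tz] sz].
case: (boolP (has (fun x => x <= V)%N b)) => [/hasP[x xb xV]|/hasPn big].
  have /= bperm := perm_to_rem xb.
  have bprod : (\prod_(y <- b) y = x * \prod_(y <- rem x b) y)%N.
    by rewrite (perm_big _ bperm) big_cons.
  have /andP[x0 _] := allP bV _ xb.
  have [||||c [ck cV cE]] := IHs (x * t :: rem x b)%N.
  - by rewrite /= size_rem // bk prednK.
  - rewrite /= muln_gt0 x0 t0 leq_mul //=.
    by apply/allP => y /mem_rem; apply: allP bV y.
  - exact: sz.
  - by apply: leq_trans le_V; rewrite !big_cons bprod; apply: eq_leq; ring.
  by exists c; split=> //; rewrite cE !big_cons bprod; ring.
suff : (V ^ k < \prod_(x <- b) x)%N.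
  have P_gt0 : (0 < \prod_(x <- t :: s) x)%N.
    rewrite big_seq; apply: prodn_cond_gt0 => x.
    by rewrite inE => /orP[/eqP->//|/(allP sz)/andP[]].
  by move=> lt_V; have := leq_trans lt_V (leq_trans (leq_pmulr _ P_gt0) le_V); rewrite ltnn.
clear IHs bV le_V; elim: b k k_gt0 bk big => [|x b IHb] k k_gt0 /= bk big; first by rewrite -bk in k_gt0.
rewrite -bk expnS big_cons.
have xV : (V < x)%N by rewrite ltnNge big // inE eqxx.
have Hb : (V ^ size b <= \prod_(y <- b) y)%N.
  case: (posnP (size b)) => [/size0nil->|b0]; first by rewrite big_nil.
  apply/ltnW/IHb => // y yb; apply: big; by rewrite inE yb orbT.
have Hb0 : (0 < \prod_(y <- b) y)%N.
  rewrite big_seq; apply: prodn_cond_gt0 => y yb.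
  by apply: leq_ltn_trans (leq0n V) _; rewrite ltnNge big // inE yb orbT.
by apply: leq_ltn_trans (leq_mul (leqnn V) Hb) _; rewrite ltn_mul2r Hb0 xV.
Qed.

(** * Fermat quotients and additive characters *)

Definition fq (p x : nat) : 'F_p := (fermat_quotient p x)%:~R.

Section FermatQuotient.

Variable p : nat.
Hypothesis p_pr : prime p.

Local Notation w x := ((x ^ p.-1).-1 %/ p)%N.

Lemma natFp_eq0 (n : nat) : ((n%:R : 'F_p) == 0) = (p %| n)%N.
Proof. by rewrite (dvdn_pcharf (pchar_Fp p_pr)). Qed.

Lemma natFp_neq0 (n : nat) : coprime n p -> (n%:R : 'F_p) != 0.
Proof. by rewrite natFp_eq0 coprime_sym prime_coprime. Qed.

Lemma natFp_p : (p%:R : 'F_p) = 0.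
Proof. by apply/eqP; rewrite natFp_eq0. Qed.

Lemma natFp_eqmod (m n : nat) : ((m%:R : 'F_p) == n%:R) = (m == n %[mod p]).
Proof.
wlog le_nm : m n / (n <= m)%N.
  by move=> H; case: (leqP n m) => [/H//|/ltnW/H]; rewrite eq_sym => ->; rewrite eq_sym.
by rewrite -subr_eq0 -natrB // natFp_eq0 eqn_mod_dvd.
Qed.

Lemma intFp_mod (a : int) : ((a %% p)%Z%:~R : 'F_p) = a%:~R.
Proof.
have -> : a%:~R = ((a %/ p)%Z * p)%:~R + (a %% p)%Z%:~R :> 'F_p.
  by rewrite -intrD -divz_eq.
by rewrite intrM -[p%:~R]/(p%:R : 'F_p) natFp_p mulr0 add0r.
Qed.

Lemma fermat_pow (x : nat) : coprime x p -> (x ^ p.-1 = (w x * p).+1)%N.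
Proof.
move=> cxp; have x_gt0 : (0 < x)%N.
  by case: x cxp => //; rewrite /coprime gcd0n => /eqP p1; move: (prime_gt1 p_pr); rewrite p1.
have := dvdz_fermat p_pr (cxp : coprimez x p).
rewrite -rmorphXn /= -[1]/(1%:Z) subzn ?natrXE ?expn_gt0 ?x_gt0 // subn1.
rewrite dvdzE /= => dvd.
by rewrite divnK // prednK // expn_gt0 x_gt0.
Qed.

Lemma fqE (x : nat) : coprime x p -> fq p x = (w x)%:R.
Proof.
move=> cxp; rewrite /fq /fermat_quotient (cxp : coprimez x p) intFp_mod.
have -> : (x%:Z ^+ p.-1 - 1 = (w x * p)%N%:Z)%R.
  by rewrite -rmorphXn /= natrXE [in LHS](fermat_pow cxp) -addn1 PoszD addrK.
by rewrite PoszM mulzK // -lt0n prime_gt0.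
Qed.

(** This is (1 + ap)(1 + bp) = 1 + (a + b + abp)p. *)
Lemma fqM (x y : nat) : coprime x p -> coprime y p -> fq p (x * y) = fq p x + fq p y.
Proof.
move=> cx cy; have cxy : coprime (x * y) p by rewrite coprimeMl cx.
rewrite !fqE // -natrD; apply/eqP; rewrite natFp_eqmod.
suff -> : w (x * y) = (w x + w y + w x * w y * p)%N by rewrite addnC modnMDl.
move: (fermat_pow cx) (fermat_pow cy) (fermat_pow cxy).
move: (w x) (w y) (w (x * y)) => a b c Ea Eb Ec.
apply/eqP; rewrite -(eqn_pmul2r (prime_gt0 p_pr)) -eqSS -Ec expnMn Ea Eb; apply/eqP.
ring.
Qed.

Lemma fq1 : fq p 1 = 0.
Proof.
have := fqM (coprime1n p) (coprime1n p); rewrite muln1 => /eqP.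
by rewrite -subr_eq0 opprD addrA subrr sub0r oppr_eq0 => /eqP.
Qed.

Lemma coprimenDp (x k : nat) : coprime (x + p * k) p = coprime x p.
Proof. by rewrite -coprime_modl addnC mulnC modnMDl coprime_modl. Qed.

(** First-order binomial expansion of (x + pk)^(p-1) modulo p^2; in F_p the factor p - 1 is -1 and
    x^(p-2) is 1/x. *)
Lemma fqDp (x k : nat) : coprime x p -> fq p (x + p * k) = fq p x - k%:R / x%:R.
Proof.
move=> cx; have cxk : coprime (x + p * k) p by rewrite coprimenDp.
have p_gt1 := prime_gt1 p_pr.
have binomial1 m : exists R : nat,
    ((x + p * k) ^ m.+1 = x ^ m.+1 + m.+1 * x ^ m * (p * k) + p * p * R)%N.
  elim: m => [|m [R IH]]; first by exists 0%N; rewrite !expn1 expn0; ring.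
  exists (m.+1 * x ^ m * k * k + R * (x + p * k))%N.
  rewrite expnS IH [(x ^ m.+2)%N]expnS [(x ^ m.+1)%N]expnS -addn1; ring.
have [m pE] : exists m, p = m.+2 by case: (p) p_gt1 => [|[|m]] //; exists m.
have [R HR] := binomial1 m; have p1E : p.-1 = m.+1 by rewrite {1}pE.
have wE : (w (x + p * k) = w x + p.-1 * x ^ m * k + p * R)%N.
  move: (fermat_pow cx) (fermat_pow cxk); rewrite -p1E in HR.
  move: (w x) (w (x + p * k)) => a b Ea Eb; apply/eqP.
  by rewrite -(eqn_pmul2r (prime_gt0 p_pr)) -eqSS -Eb HR Ea; apply/eqP; ring.
rewrite !fqE // wE !natrD !natrM natFp_p mul0r addr0; congr (_ + _).
have x0 := natFp_neq0 cx.
apply: (mulIf x0); rewrite mulNr divfK //.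
have -> : ((p.-1)%:R : 'F_p) = -1.
  by apply/eqP; rewrite -subr_eq0 opprK natr1 prednK ?prime_gt0 // natFp_p.
have xm : (x%:R : 'F_p) * (x ^ m)%:R = 1.
  by rewrite -natrM -expnS -p1E (fermat_pow cx) -natr1 natrM natFp_p mulr0 add0r.
by rewrite mulN1r !mulNr mulrAC [_ * x%:R]mulrC xm mul1r.
Qed.

(** By [fqDp] the lifts x + pk of a unit modulo p have quotients differing by k / x, so equal
    quotients force p to divide k. *)
Lemma fq_inj_mod (x y : nat) : coprime x p -> coprime y p ->
  x = y %[mod p] -> fq p x = fq p y -> x = y %[mod p ^ 2].
Proof.
wlog le_xy : x y / (x <= y)%N.
  move=> H cx cy xy qxy; case: (leqP x y) => [le|/ltnW le]; first exact: H.
  by symmetry; apply: H.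
move=> cx cy /eqP; rewrite eq_sym eqn_mod_dvd // => /dvdnP[k ykE].
have -> : y = (x + p * k)%N by rewrite mulnC -ykE subnKC.
rewrite fqDp // => /eqP; rewrite -subr_eq0 opprB addrC subrK mulf_eq0 invr_eq0.
rewrite (negPf (natFp_neq0 cx)) orbF natFp_eq0 => /dvdnP[j ->].
by rewrite mulnCA mulnn addnC modnMDl.
Qed.

Lemma fq_eqmod (x y : nat) : coprime x p -> x = y %[mod p ^ 2] -> fq p x = fq p y.
Proof.
wlog le_xy : x y / (x <= y)%N.
  move=> H cx xy; case: (leqP x y) => [le|/ltnW le]; first exact: H.
  symmetry; apply: H => //; move: cx.
  have E t : (t %% p ^ 2)%N = t %[mod p] by rewrite modn_dvdm // dvdn_exp.
  by rewrite -coprime_modl -E xy E coprime_modl.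
move=> cx /eqP; rewrite eq_sym eqn_mod_dvd // => /dvdnP[k ykE].
have -> : y = (x + p * (p * k))%N by rewrite mulnA mulnn mulnC -ykE subnKC.
by rewrite fqDp // natrM natFp_p !mul0r subr0.
Qed.

Lemma coprime_prod_all (s : seq nat) : all (fun x => coprime x p) s ->
  coprime (\prod_(x <- s) x) p.
Proof.
elim: s => [|x s IHs] /=; first by rewrite big_nil coprime1n.
by move=> /andP[cx cs]; rewrite big_cons coprimeMl cx IHs.
Qed.

Lemma fq_prod (s : seq nat) : all (fun x => coprime x p) s ->
  fq p (\prod_(x <- s) x) = \sum_(x <- s) fq p x.
Proof.
elim: s => [|x s IHs] /=; first by rewrite !big_nil fq1.
move=> /andP[cx cs]; rewrite !big_cons fqM ?IHs //.
exact: coprime_prod_all.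
Qed.

End FermatQuotient.

Section AdditiveCharacter.

Variable p : nat.
Hypothesis p_pr : prime p.

Definition ec (x : 'F_p) : algC := sval (C_prim_root_exists (prime_gt0 p_pr)) ^+ x.

Let zeta_prim : p.-primitive_root (sval (C_prim_root_exists (prime_gt0 p_pr))).
Proof. exact: svalP (C_prim_root_exists _). Qed.

Lemma ec0 : ec 0 = 1. Proof. by []. Qed.

Lemma ecD (x y : 'F_p) : ec (x + y) = ec x * ec y.
Proof.
rewrite /ec -exprD -[RHS](prim_expr_mod zeta_prim) /=.
by congr (_ ^+ (_ %% _)); apply: Fp_cast.
Qed.

Lemma norm_ec (x : 'F_p) : `|ec x| = 1.
Proof.
apply/eqP; rewrite -(pexpr_eq1 (n := p)) ?prime_gt0 // -normrX.
by rewrite /ec exprAC (prim_expr_order zeta_prim) expr1n normr1.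
Qed.

Lemma conj_ec (x : 'F_p) : (ec x)^* = ec (- x).
Proof.
have ecx : ec x * ec (- x) = 1 by rewrite -ecD subrr ec0.
have ec_neq0 : ec x != 0 by rewrite -normr_eq0 norm_ec oner_eq0.
by apply: (mulfI ec_neq0); rewrite ecx -normCK norm_ec expr1n.
Qed.

Lemma ec_sum (I : Type) (r : seq I) (P : pred I) (F : I -> 'F_p) :
  ec (\sum_(i <- r | P i) F i) = \prod_(i <- r | P i) ec (F i).
Proof. exact: (big_morph ec ecD ec0). Qed.

Lemma sum_ec (x : 'F_p) : \sum_c ec (c * x) = if x == 0 then p%:R else 0.
Proof.
case: eqP => [->|/eqP x0].
  rewrite (eq_bigr (fun=> 1)) => [|c _]; last by rewrite mulr0.
  by rewrite sumr_const card_Fp.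
have ec_neq1 : ec x != 1.
  rewrite /ec -(prim_order_dvd zeta_prim); apply: contra x0 => dvd.
  by rewrite -(natr_Zp x) natFp_eq0.
(* Translating [c] by 1 multiplies the sum by [ec x], which is not 1; hence the sum vanishes. *)
rewrite -[RHS](mul0r (ec x - 1)^-1); apply: (canRL (mulfK _)).
  by rewrite subr_eq0.
rewrite mulrBr mulr1 mulr_suml [X in _ - X](reindex_inj (addIr 1)) /=.
rewrite -sumrB big1 // => c _.
by rewrite mulrDl mul1r ecD subrr.
Qed.

End AdditiveCharacter.

(** * Moments *)

Section PowerMeans.

Variables (F : numFieldType) (I : finType).
Implicit Types (w v a b : I -> F).

(* Chebyshev's sum inequality: expand (v i - v j) (v i ^+ k - v j ^+ k) >= 0. *)
Lemma chebyshev_sum (k : nat) w v : (forall i, 0 <= w i) -> (forall i, 0 <= v i) ->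
  (\sum_i w i * v i) * (\sum_i w i * v i ^+ k) <=
  (\sum_i w i) * (\sum_i w i * v i ^+ k.+1).
Proof.
move=> w0 v0; rewrite -(ler_pMn2r (n := 2)) // !mulr2n.
have double f g : (\sum_i f i) * (\sum_i g i) + (\sum_i f i) * (\sum_i g i) =
    \sum_i \sum_j (f i * g j + f j * g i) :> F.
  rewrite {2}[_ * _]mulrC !big_distrlr /= -big_split /=; apply: eq_bigr => i _.
  by rewrite -big_split /=; apply: eq_bigr => j _; rewrite [g i * _]mulrC.
rewrite !double.
apply: ler_sum => i _; apply: ler_sum => j _.
have -> : w i * v i * (w j * v j ^+ k) + w j * v j * (w i * v i ^+ k) =
          w i * w j * (v i * v j ^+ k + v i ^+ k * v j) by ring.
have -> : w i * (w j * v j ^+ k.+1) + w j * (w i * v i ^+ k.+1) =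
          w i * w j * (v j ^+ k.+1 + v i ^+ k.+1) by ring.
apply: ler_wpM2l; first exact: mulr_ge0.
rewrite -subr_ge0.
have -> : v j ^+ k.+1 + v i ^+ k.+1 - (v i * v j ^+ k + v i ^+ k * v j) =
          (v i - v j) * (v i ^+ k - v j ^+ k) by rewrite !exprS; ring.
have [le|/ltW le] := real_leP (ger0_real (v0 i)) (ger0_real (v0 j)).
  by apply: mulr_le0; rewrite subr_le0 ?lerXn2r ?nnegrE.
by apply: mulr_ge0; rewrite subr_ge0 ?lerXn2r ?nnegrE.
Qed.

Lemma power_mean (k : nat) w v : (forall i, 0 <= w i) -> (forall i, 0 <= v i) ->
  (\sum_i w i * v i) ^+ k.+1 <= (\sum_i w i) ^+ k * (\sum_i w i * v i ^+ k.+1).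
Proof.
move=> w0 v0.
have W0 : 0 <= \sum_i w i by apply: sumr_ge0.
have S0 : 0 <= \sum_i w i * v i by apply: sumr_ge0 => i _; apply: mulr_ge0.
elim: k => [|k IHk]; first by rewrite expr0 mul1r expr1.
rewrite exprS; apply: le_trans (ler_wpM2l S0 IHk) _.
rewrite mulrCA exprSr -mulrA; apply: ler_wpM2l; first exact: exprn_ge0.
exact: chebyshev_sum.
Qed.

(** Hoelder's inequality with exponents k+1 and (k+1)/k, raised to the power k+1 so that no roots
    occur. *)
Lemma holder_pow (k : nat) a b : (forall i, 0 <= a i) -> (forall i, 0 <= b i) ->
  (\sum_i a i * b i ^+ k) ^+ k.+1 <=
  (\sum_i a i ^+ k.+1) * (\sum_i b i ^+ k.+1) ^+ k.
Proof.
case: k => [|k] a0 b0.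
  by rewrite expr0 mulr1 !expr1; under eq_bigr do rewrite expr0 mulr1.
(* With weights b ^+ k.+2 this is the power mean inequality for a / b; both sides
   vanish where b does, since x / 0 = 0. *)
have -> : \sum_i a i * b i ^+ k.+1 = \sum_i b i ^+ k.+2 * (a i / b i).
  apply: eq_bigr => i _; have [->|bi0] := eqVneq (b i) 0.
    by rewrite !expr0n /= mulr0 mul0r.
  by rewrite [in RHS]exprSr -mulrA [b i * _]mulrCA divff // mulr1 mulrC.
have b1 i : 0 <= b i ^+ k.+2 by apply: exprn_ge0.
have ab i : 0 <= a i / b i by rewrite mulr_ge0 // invr_ge0.
apply: le_trans (power_mean k.+1 b1 ab) _.
rewrite mulrC; apply: ler_wpM2r; first by apply/exprn_ge0/sumr_ge0.
apply: ler_sum => i _; have [->|bi0] := eqVneq (b i) 0.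
  by rewrite expr0n /= mul0r exprn_ge0.
by rewrite expr_div_n mulrC divfK // expf_neq0.
Qed.

End PowerMeans.

Section Moments.

Variable p : nat.
Hypothesis p_pr : prime p.
Local Notation ec := (ec p_pr).

Lemma moment2 (T : finType) (w : T -> algC) (f : T -> 'F_p) :
  \sum_c `|\sum_t w t * ec (c * f t)| ^+ 2 =
  p%:R * \sum_(tt : T * T | f tt.1 == f tt.2) w tt.1 * (w tt.2)^*.
Proof.
under eq_bigr => c _ do rewrite normCK rmorph_sum big_distrlr /=.
rewrite exchange_big mulr_sumr [RHS]big_mkcond /=.
rewrite -(pair_bigA _ (fun t s => if f t == f s then p%:R * (w t * (w s)^*) else 0)) /=.
apply: eq_bigr => t _; rewrite exchange_big; apply: eq_bigr => s _ /=.
transitivity (w t * (w s)^* * \sum_c ec (c * (f t - f s))).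
  rewrite mulr_sumr; apply: eq_bigr => c _.
  by rewrite rmorphM /= conj_ec mulrACA -ecD -mulrN -mulrDr.
by rewrite sum_ec subr_eq0; case: ifP => _; rewrite ?mulr0 // mulrC.
Qed.

Lemma moment2_eq (T : finType) (f : T -> 'F_p) :
  \sum_c `|\sum_t ec (c * f t)| ^+ 2 =
  (p * #|[set tt : T * T | f tt.1 == f tt.2]|)%:R.
Proof.
rewrite natrM -sum1_card natr_sum.
transitivity (\sum_c `|\sum_t 1 * ec (c * f t)| ^+ 2).
  by apply: eq_bigr => c _; congr (`|_| ^+ 2); apply: eq_bigr => t _; rewrite mul1r.
rewrite (moment2 (fun=> 1) f); congr (_ * _).
by apply: eq_big => [tt|tt _]; rewrite ?inE // rmorph1 mulr1.
Qed.

(** Weights of absolute value at most 1 cost nothing in an even moment; this lets the sign [sg] into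
    the sixth moment. *)
Lemma moment2_le (T : finType) (w : T -> algC) (f : T -> 'F_p) :
  (forall t, `|w t| <= 1) ->
  \sum_c `|\sum_t w t * ec (c * f t)| ^+ 2 <=
  (p * #|[set tt : T * T | f tt.1 == f tt.2]|)%:R.
Proof.
move=> w1; rewrite -[leLHS]ger0_norm; last by apply: sumr_ge0 => c _; apply: exprn_ge0.
rewrite moment2 normrM natrM normr_nat; apply: ler_wpM2l; first exact: ler0n.
rewrite -sum1_card natr_sum; apply: le_trans (ler_norm_sum _ _ _) _.
rewrite [leRHS](eq_bigl (fun tt => f tt.1 == f tt.2)) => [|tt]; last by rewrite inE.
by apply: ler_sum => tt _; rewrite normrM norm_conjC mulr_ile1.
Qed.

Lemma sum_ec_pow (T : finType) (w : T -> algC) (f : T -> 'F_p) (k : nat) (c : 'F_p) :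
  (\sum_t w t * ec (c * f t)) ^+ k =
  \sum_(u : {ffun 'I_k -> T}) (\prod_i w (u i)) * ec (c * \sum_i f (u i)).
Proof.
rewrite -[in LHS](card_ord k) -prodr_const bigA_distr_bigA /=.
by apply: eq_bigr => u _; rewrite big_split /= mulr_sumr ec_sum.
Qed.

End Moments.

Section Ratios.

Variable p : nat.
Hypothesis p_pr : prime p.

Definition ratio (x y : nat) : 'F_p := x%:R / y%:R.

(* A class with q_p = 0 modulo p has a unique lift to p^2, so x / y modulo p already
   determines x / y modulo p^2 when q_p(x) = q_p(y). *)
Lemma ratio_cross_mod (x y x' y' : nat) :
  coprime x p -> coprime y p -> coprime x' p -> coprime y' p ->
  fq p x = fq p y -> fq p x' = fq p y' -> ratio x y = ratio x' y' ->
  (x * y' = x' * y %[mod p ^ 2])%N.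
Proof.
move=> cx cy cx' cy' q q' /eqP.
rewrite eqr_div ?natFp_neq0 // -!natrM natFp_eqmod // => /eqP E.
by apply: fq_inj_mod; rewrite ?coprimeMl ?cx ?cy ?cx' ?cy' // !fqM // q q' addrC.
Qed.

Lemma ratio_cross_eq (x y x' y' : nat) :
  coprime x p -> coprime y p -> coprime x' p -> coprime y' p ->
  fq p x = fq p y -> fq p x' = fq p y' -> ratio x y = ratio x' y' ->
  (x < p)%N -> (y < p)%N -> (x' < p)%N -> (y' < p)%N -> (x * y' = x' * y)%N.
Proof.
move=> cx cy cx' cy' q q' r lx ly lx' ly'.
have := ratio_cross_mod cx cy cx' cy' q q' r.
by rewrite !modn_small // -mulnn ltn_mul.
Qed.

Lemma coprime_cross_eq (x y x' y' : nat) : coprime x y -> coprime x' y' ->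
  (x * y' = x' * y)%N -> x = x' /\ y = y'.
Proof.
move=> c c' E; split; apply/eqP; rewrite eqn_dvd.
  apply/andP; split.
    by rewrite -(@Gauss_dvdl x x' y) // -E dvdn_mulr.
  by rewrite -(@Gauss_dvdl x' x y') // E dvdn_mulr.
apply/andP; split.
  by rewrite -(@Gauss_dvdr y x y') 1?coprime_sym // E dvdn_mull.
by rewrite -(@Gauss_dvdr y' x' y) 1?coprime_sym // -E dvdn_mull.
Qed.

Lemma small_coprime (x : nat) : (0 < x < p)%N -> coprime x p.
Proof.
by case/andP=> x0 xp; rewrite coprime_sym prime_coprime // gtnNdvd.
Qed.

End Ratios.

Lemma coprime_prodn (I : finType) (F : I -> nat) (n : nat) :
  (forall i, coprime (F i) n) -> coprime (\prod_i F i)%N n.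
Proof.
by move=> cF; elim/big_ind: _ => [|a b|i _]; rewrite ?coprime1n // coprimeMl => -> ->.
Qed.

Lemma card_ffun_divisors (T : finType) (v : T -> nat) (k X D : nat) : injective v ->
  (0 < X)%N -> (size (divisors X) <= D)%N ->
  (#|[set u : {ffun 'I_k -> T} | [forall i, (v (u i) %| X)%N]]| <= D ^ k)%N.
Proof.
move=> v_inj X0 XD.
have -> : [set u : {ffun 'I_k -> T} | [forall i, (v (u i) %| X)%N]] =
    [set u in ffun_on [pred t | (v t %| X)%N]].
  by apply/setP => u; rewrite [LHS]inE [RHS]inE; apply/forallP/ffun_onP => H i; apply: H.
rewrite cardsE card_ffun_on card_ord leq_exp2r_w // (leq_trans _ XD) //.
rewrite cardE -(size_map v); apply: uniq_leq_size.
  by rewrite map_inj_uniq ?enum_uniq.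
by move=> d /mapP[t]; rewrite mem_enum inE => tX ->; rewrite -dvdn_divisors.
Qed.

Lemma card_bigcup_le (I T : finType) (F : I -> {set T}) :
  (#|\bigcup_i F i| <= \sum_i #|F i|)%N.
Proof.
elim/big_rec2: _ => [|i m A _ IH]; first by rewrite cards0.
by apply: leq_trans (leq_card_setU _ _) _; rewrite leq_add2l.
Qed.

(** * Even moments of the sum over tiny primes *)

Section PrimeMoment.


Variables (p : nat) (T : finType) (v : T -> nat) (z L D : nat).
Hypotheses (p_pr : prime p) (v_inj : injective v) (v_pr : forall t, prime (v t)).
Hypotheses (v_le : forall t, (v t <= z)%N) (zL : (z ^ L < p)%N).
Hypothesis tauD : forall x, (0 < x <= z ^ L)%N -> (size (divisors x) <= D)%N.

Local Notation psum c := (\sum_t ec p_pr (c * fq p (v t))).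

Local Notation tuples2 k := ({ffun 'I_k -> T} * {ffun 'I_k -> T})%type.

Definition eq_tuples (k : nat) : {set tuples2 k} :=
  [set uv : tuples2 k | \sum_i fq p (v (uv.1 i)) == \sum_i fq p (v (uv.2 i))].

Lemma psum_moment (k : nat) :
  \sum_c `|psum c| ^+ (2 * k) = (p * #|eq_tuples k|)%:R.
Proof.
rewrite -(moment2_eq p_pr (fun u : {ffun 'I_k -> T} => \sum_i fq p (v (u i)))).
apply: eq_bigr => c _; rewrite mulnC exprM -normrX; congr (`|_| ^+ 2).
have := sum_ec_pow p_pr (fun=> 1) (fun t => fq p (v t)) k c.
rewrite (eq_bigr (fun t => ec p_pr (c * fq p (v t)))) => [->|t _]; last by rewrite mul1r.
by apply: eq_bigr => u _; rewrite big1 // mul1r.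
Qed.

Let prodv (k : nat) (u : {ffun 'I_k -> T}) : nat := (\prod_i v (u i))%N.

Let prodv_gt0 (k : nat) (u : {ffun 'I_k -> T}) : (0 < prodv u)%N.
Proof. by apply: prodn_gt0 => i; apply: prime_gt0. Qed.

Let prodv_le (u : {ffun 'I_L -> T}) : (prodv u <= z ^ L)%N.
Proof.
by rewrite -[in leqRHS](card_ord L) -prod_nat_const; apply: leq_prod.
Qed.

(** The common prime cancels from the equation; together with the two shortened tuples it determines
    the pair. *)
Lemma card_eq_tuples_shared (k : nat) (i j : 'I_k.+1) :
  (#|[set uv : tuples2 k.+1 | (uv \in eq_tuples k.+1) && (uv.1 i == uv.2 j)]| <= #|T| * #|eq_tuples k|)%N.
Proof.
pose drop1 (i : 'I_k.+1) (u : {ffun 'I_k.+1 -> T}) := [ffun l => u (lift i l)].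
pose phi (uv : tuples2 k.+1) :=
  (uv.1 i, (drop1 i uv.1, drop1 j uv.2)).
rewrite -cardsT -cardsX; set A := [set _ | _].
have /card_in_imset <- : {in A &, injective phi}.
  move=> [u u'] [w w']; rewrite !inE /= => /andP[_ /eqP uE] /andP[_ /eqP wE] [E0 E1 E2].
  congr (_, _); apply/ffunP => l.
    case: (unliftP i l) => [l' ->|-> //].
    by have := congr1 (fun f : {ffun _ -> _} => f l') E1; rewrite !ffunE.
  case: (unliftP j l) => [l' ->|->]; last by rewrite -uE -wE.
  by have := congr1 (fun f : {ffun _ -> _} => f l') E2; rewrite !ffunE.
apply/subset_leq_card/subsetP => _ /imsetP[[u u'] + ->].
rewrite !inE /= => /andP[/eqP].
rewrite (bigD1_ord i) //= [in RHS](bigD1_ord j) //= => + /eqP uE.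
rewrite uE => /addrI E; apply/eqP.
under eq_bigr do rewrite ffunE; under [RHS]eq_bigr do rewrite ffunE.
exact: E.
Qed.

Let small_prodv (u : {ffun 'I_L -> T}) : coprime (prodv u) p.
Proof.
apply: small_coprime => //; rewrite prodv_gt0 //=.
by apply: leq_ltn_trans zL; apply: prodv_le.
Qed.

Let fq_prodv (u : {ffun 'I_L -> T}) : fq p (prodv u) = \sum_i fq p (v (u i)).
Proof.
rewrite /prodv -(big_map (fun i => v (u i)) xpredT id) fq_prod //; last first.
  apply/allP => _ /mapP[i _ ->].
  have := small_prodv u; rewrite /prodv (bigD1 i) //= coprimeMl => /andP[].
  by [].
by rewrite big_map.
Qed.

(** Tuples without a common prime have coprime products below p. The ratio of the products modulo p,
    one of p values, then determines both products, and the entries of each tuple are among at most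
    D divisors. *)
Lemma card_eq_tuples_disjoint :
  (#|[set uv : tuples2 L | (uv \in eq_tuples L) && [forall i, forall j, uv.1 i != uv.2 j]]| <=
   p * D ^ (2 * L))%N.
Proof.
set A := [set _ | _].
pose rat (uv : tuples2 L) := ratio p (prodv uv.1) (prodv uv.2).
rewrite -sum1_card (partition_big rat xpredT) //=.
rewrite -[X in (X * _)%N](card_Fp p_pr) -sum_nat_const; apply: leq_sum => g _.
rewrite sum1dep_card.
set B := [set _ | _].
have [->|[[u0 w0] uw0B]] := set_0Vmem B; first by rewrite cards0.
have coprodv u w : (u, w) \in A -> coprime (prodv u) (prodv w).
  rewrite inE /= => /andP[_ /forallP dis]; apply: coprime_prodn => i.
  rewrite coprime_sym; apply: coprime_prodn => j; rewrite coprime_sym prime_coprime // dvdn_prime2 //.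
  by apply: contraNN (forallP (dis i) j) => /eqP/v_inj->.
pose DV X := [set u : {ffun 'I_L -> T} | [forall i, (v (u i) %| X)%N]].
apply: leq_trans (_ : #|setX (DV (prodv u0)) (DV (prodv w0))| <= _)%N; last first.
  by rewrite cardsX mulnC mul2n -addnn expnD; apply: leq_mul;
     apply: card_ffun_divisors => //; apply: tauD; rewrite prodv_gt0 prodv_le.
apply/subset_leq_card/subsetP => -[u w]; rewrite inE => /andP[uwA /eqP ruw].
have := uw0B; rewrite inE => /andP[uw0A /eqP ruw0].
have lt_p (x : {ffun 'I_L -> T}) : (prodv x < p)%N by apply: leq_ltn_trans (prodv_le x) zL.
have [Eu Ew] : prodv u = prodv u0 /\ prodv w = prodv w0.
  apply: coprime_cross_eq; [exact: coprodv | exact: coprodv | ].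
  apply: (@ratio_cross_eq p) => //; try exact: small_prodv; try exact: lt_p.
  - by rewrite !fq_prodv; move: uwA; rewrite !inE /= => /andP[/eqP].
  - by rewrite !fq_prodv; move: uw0A; rewrite !inE /= => /andP[/eqP].
  - by rewrite -[LHS]/(rat (u, w)) ruw -ruw0.
have dvd_prodv (x : {ffun 'I_L -> T}) i : (v (x i) %| prodv x)%N.
  by rewrite /prodv (bigD1 i) //= dvdn_mulr.
by rewrite !inE /= -Eu -Ew; apply/andP; split; apply/forallP => i; apply: dvd_prodv.
Qed.

Lemma card_eq_tuples_rec : (0 < L)%N ->
  (#|eq_tuples L| <= p * D ^ (2 * L) + L ^ 2 * (#|T| * #|eq_tuples L.-1|))%N.
Proof.
move=> L_gt0; have := card_eq_tuples_disjoint.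
have [k L_E] : exists k, L = k.+1 by exists L.-1; rewrite prednK.
rewrite L_E /= => dis.
set A := [set _ | _] in dis.
have cover : eq_tuples k.+1 \subset A :|:
    \bigcup_(ij : 'I_k.+1 * 'I_k.+1) [set uv : tuples2 k.+1 | (uv \in eq_tuples k.+1) && (uv.1 ij.1 == uv.2 ij.2)].
  apply/subsetP => uv uvE; rewrite in_setU in_set uvE /=.
  case: (boolP [forall i, forall j, uv.1 i != uv.2 j]) => //= .
  rewrite negb_forall => /existsP[i]; rewrite negb_forall => /existsP[j].
  rewrite negbK => uvij; apply/bigcupP; exists (i, j) => //.
  by rewrite inE uvE.
apply: leq_trans (subset_leq_card cover) _.
apply: leq_trans (leq_card_setU _ _) _; apply: leq_add dis _.
apply: leq_trans (card_bigcup_le _) _.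
apply: (@leq_trans (\sum_(ij : 'I_k.+1 * 'I_k.+1) (#|T| * #|eq_tuples k|))%N).
  by apply: leq_sum => ij _; apply: card_eq_tuples_shared.
by rewrite sum_nat_const card_prod card_ord mulnn.
Qed.

Lemma psum_moment_le : (0 < L)%N ->
  \sum_c `|psum c| ^+ (2 * L) <= (2 * p ^ 2 * D ^ (2 * L) + p * (2 * L ^ 2 * #|T|) ^ L)%:R.
Proof.
move=> L_gt0.
(* Twice the coefficient in [card_eq_tuples_rec]: the recursion bounds 2E, its lower moment is at
   most [E + p * G ^ L], and one E cancels. *)
set G := (2 * L ^ 2 * #|T|)%N.
set E := \sum_c _.
(* Absorbs the lower moment of [card_eq_tuples_rec] into the moment itself. *)
have young (x : algC) : 0 <= x -> G%:R * x ^+ L.-1 <= x ^+ L + G%:R ^+ L.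
  move=> x0; have [le|/ltW le] := real_leP (ger0_real x0) (realn _ G).
    have -> : G%:R ^+ L = G%:R * G%:R ^+ L.-1 :> algC by rewrite -exprS prednK.
    rewrite -[leLHS]add0r lerD ?exprn_ge0 //.
    by apply: ler_wpM2l; rewrite ?ler0n // lerXn2r ?nnegrE ?ler0n.
  have -> : x ^+ L = x * x ^+ L.-1 by rewrite -exprS prednK.
  rewrite -[leLHS]addr0 lerD ?exprn_ge0 ?ler0n //.
  by apply: ler_wpM2r => //; apply: exprn_ge0.
have sum_young : G%:R * (p * #|eq_tuples L.-1|)%:R <= E + (p * G ^ L)%:R.
  rewrite -psum_moment mulr_sumr.
  have -> : (p * G ^ L)%:R = \sum_(c : 'F_p) G%:R ^+ L :> algC.
    by rewrite sumr_const card_Fp // natrM natrX mulrC mulr_natr.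
  rewrite /E -big_split /=; apply: ler_sum => c _.
  by rewrite !exprM; apply: young; apply: exprn_ge0.
have E2 : E + E <= (2 * p ^ 2 * D ^ (2 * L))%:R + G%:R * (p * #|eq_tuples L.-1|)%:R.
  rewrite /E !psum_moment -!natrD -natrM -natrD ler_nat /G.
  by have := card_eq_tuples_rec L_gt0; nia.
rewrite -(lerD2l E) (le_trans E2) // natrD addrCA lerD2l.
exact: sum_young.
Qed.

End PrimeMoment.

(** * Pairs with equal Fermat quotients *)

Lemma card_ord_lt (n m : nat) : (#|[pred j : 'I_n | (j < m)%N]| <= m)%N.
Proof.
rewrite -[leqRHS](size_iota 0) cardE -(size_map val); apply: uniq_leq_size.
  by rewrite (map_inj_uniq val_inj) enum_uniq.
by move=> d /mapP[j]; rewrite mem_enum inE mem_iota /= => jm ->.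
Qed.

(** Integer points on a line parallel to the primitive vector (x0, y0) differ by multiples of it, so
    the quotient by x0 tells them apart. *)
Lemma lattice_line_inj (x0 y0 x y x' y' : nat) : coprime x0 y0 -> (0 < x0)%N ->
  (x * y0 + x0 * y' = x' * y0 + x0 * y)%N -> (x %/ x0 = x' %/ x0)%N ->
  x = x' /\ y = y'.
Proof.
move=> c x0_gt0 E q.
have xx' : x = x'.
  wlog le_x : x y x' y' E q / (x <= x')%N.
    move=> H; case: (leqP x x') => [le|/ltnW le]; first exact: (H x y x' y').
    by symmetry; apply: (H x' y' x y).
  have E' : (y' * x0 + x * y0 = y * x0 + x' * y0)%N by lia.
  have : (x * y0 == x' * y0 %[mod x0])%N.
    by rewrite -(modnMDl y' (x * y0)) -(modnMDl y (x' * y0)) E'.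
  rewrite eq_sym eqn_mod_dvd ?leq_mul2r ?le_x ?orbT // -mulnBl Gauss_dvdl //.
  rewrite -eqn_mod_dvd // => /eqP m.
  by rewrite (divn_eq x x0) (divn_eq x' x0) q m.
split=> //; move: E; rewrite xx' => /addnI/eqP.
by rewrite eqn_pmul2l // => /eqP.
Qed.

(** With truncated subtraction [a - b + (b - a)] is the distance of a and b; with the sign it fixes
    the difference. *)
Lemma distn_cross (a b a' b' : nat) : (b <= a)%N = (b' <= a')%N ->
  (a - b + (b - a) = a' - b' + (b' - a') -> a + b' = a' + b)%N.
Proof. by case: (leqP b a); case: (leqP b' a') => //; lia. Qed.

Section LatticeCount.

Variables (p X Y : nat).
Hypotheses (p_pr : prime p) (Y_gt0 : (0 < Y)%N).

Definition fq_pairs : {set 'I_X * 'I_X} :=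
  [set xy : 'I_X * 'I_X | [&& coprime xy.1.+1 p, coprime xy.2.+1 p &
     fq p xy.1.+1 == fq p xy.2.+1]].

Let height (xy : 'I_X * 'I_X) : nat := maxn xy.1.+1 xy.2.+1.
Let class (g : 'F_p) := [set xy in fq_pairs | ratio p xy.1.+1 xy.2.+1 == g].

(* A point of minimal height is primitive. *)
Let class_dvd (g : 'F_p) (xy : 'I_X * 'I_X) (d : nat) : xy \in class g ->
  (d %| xy.1.+1)%N -> (d %| xy.2.+1)%N -> (1 < d)%N ->
  exists2 xy', xy' \in class g & (height xy' < height xy)%N.
Proof.
case: xy => x y; rewrite !inE /= => /andP[/and3P[cx cy /eqP q] /eqP r] /dvdnP[a xE] /dvdnP[b yE] d1.
have a_gt0 : (0 < a)%N by case: a xE.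
have b_gt0 : (0 < b)%N by case: b yE.
have ax : (a < x.+1)%N by rewrite xE ltn_Pmulr.
have by' : (b < y.+1)%N by rewrite yE ltn_Pmulr.
have aX : (a.-1 < X)%N by have := ltn_ord x; lia.
have bX : (b.-1 < X)%N by have := ltn_ord y; lia.
exists (Ordinal aX, Ordinal bX); last first.
  by rewrite /height /= !prednK //; lia.
move: cx cy q r; rewrite xE yE !coprimeMl => /andP[ca cd] /andP[cb _].
rewrite !fqM // => /addIr q r; rewrite !inE /= !prednK // ca cb q eqxx /= -r.
have d0 := natFp_neq0 p_pr cd.
by rewrite /ratio !natrM -mulf_div divff // mulr1 eqxx.
Qed.

(** The class lies in a lattice of determinant p^2. Its points are counted on lines parallel to the
    primitive vector [xy0]: the first term is area over determinant, the second the number of points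
    on a single line. *)
Let class_card_min (g : 'F_p) (xy0 : 'I_X * 'I_X) : xy0 \in class g ->
  (forall xy, xy \in class g -> height xy0 <= height xy)%N ->
  (#|class g| <= 4 * (X ^ 2 %/ p ^ 2) + 4 * (X %/ height xy0))%N.
Proof.
move=> in0 min0; set M := height xy0.
have cop0 : coprime xy0.1.+1 xy0.2.+1.
  rewrite /coprime eqn_leq gcdn_gt0 /= andbT leqNgt; apply/negP => d1.
  have [xy' in' lt'] := class_dvd in0 (dvdn_gcdl _ _) (dvdn_gcdr _ _) d1.
  by have := min0 _ in'; rewrite leqNgt lt'.
have M_gt0 : (0 < M)%N by rewrite /M /height leq_max.
have MX : (M <= X)%N by rewrite /M /height geq_max !ltn_ord.
have p2_gt0 : (0 < p ^ 2)%N by rewrite expn_gt0 prime_gt0.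
set K := (X * M %/ p ^ 2)%N; set J := (X %/ M)%N.
pose up (xy : 'I_X * 'I_X) := (xy.1.+1 * xy0.2.+1)%N.
pose dn (xy : 'I_X * 'I_X) := (xy0.1.+1 * xy.2.+1)%N.
pose dist (xy : 'I_X * 'I_X) := ((up xy - dn xy) + (dn xy - up xy))%N.
pose pos (xy : 'I_X * 'I_X) :=
  (if (xy0.2 <= xy0.1)%N then xy.1.+1 %/ xy0.1.+1 else xy.2.+1 %/ xy0.2.+1)%N.
(* The cross product with the shortest vector is a multiple of p^2; given its value,
   the point is determined by its position along that vector. *)
pose phi xy : bool * 'I_K.+1 * 'I_J.+1 :=
  ((dn xy <= up xy)%N, inord (dist xy %/ p ^ 2), inord (pos xy)).
have up_le xy : (up xy <= X * M)%N.
  by rewrite /up leq_mul ?ltn_ord // /M /height leq_max leqnn orbT.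
have dn_le xy : (dn xy <= X * M)%N.
  by rewrite /dn mulnC leq_mul ?ltn_ord // /M /height leq_max leqnn.
have dist_le xy : (dist xy %/ p ^ 2 < K.+1)%N.
  rewrite ltnS; apply: leq_div2r; have := up_le xy; have := dn_le xy.
  by rewrite /dist; lia.
have pos_le xy : (pos xy < J.+1)%N.
  rewrite ltnS /pos /J /M /height; case: ifPn => H.
    by rewrite (maxn_idPl _) ?ltnS // leq_div2r // ltn_ord.
  have /maxn_idPr-> : (xy0.1.+1 <= xy0.2.+1)%N by rewrite ltnS ltnW // ltnNge.
  by rewrite leq_div2r // ltn_ord.
have cong xy : xy \in class g -> (p ^ 2 %| dist xy)%N.
  move: in0; rewrite !inE => /andP[/and3P[cx0 cy0 /eqP q0] /eqP r0].
  move=> /andP[/and3P[cx cy /eqP q] /eqP r].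
  have /eqP := ratio_cross_mod p_pr cx cy cx0 cy0 q q0 (etrans r (esym r0)).
  rewrite -/(up xy) -/(dn xy) /dist.
  case: (leqP (up xy) (dn xy)) => H.
    have /eqP-> : (up xy - dn xy == 0)%N by rewrite subn_eq0.
    by rewrite eq_sym eqn_mod_dvd.
  have /eqP-> : (dn xy - up xy == 0)%N by rewrite subn_eq0 ltnW.
  by rewrite eqn_mod_dvd ?addn0 // ltnW.
have phi_inj : {in class g &, injective phi}.
  move=> xy xy' /cong dvd /cong dvd' [E1 /(congr1 val) + /(congr1 val)].
  rewrite /= !inordK // => /(congr1 (fun t => (t * p ^ 2)%N)); rewrite !divnK // => E2 E3.
  have E : (up xy + dn xy' = up xy' + dn xy)%N.
    exact: distn_cross E1 E2.
  case: xy xy' {dvd dvd' E1 E2} E E3 => x y [x' y']; rewrite /up /dn /pos /= => E.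
  case: ifP => _ Eq.
    by have [/succn_inj/val_inj-> /succn_inj/val_inj->] := lattice_line_inj cop0 isT E Eq.
  have cop0' : coprime xy0.2.+1 xy0.1.+1 by rewrite coprime_sym.
  have E' : (y.+1 * xy0.1.+1 + xy0.2.+1 * x'.+1 = y'.+1 * xy0.1.+1 + xy0.2.+1 * x.+1)%N.
    by rewrite addnC ![(xy0.2.+1 * _)%N]mulnC ![(_ * xy0.1.+1)%N]mulnC -E addnC.
  by have [/succn_inj/val_inj-> /succn_inj/val_inj->] := lattice_line_inj cop0' isT E' Eq.
have : (#|class g| <= #|{: bool * 'I_K.+1 * 'I_J.+1}|)%N.
  by rewrite -(card_in_imset phi_inj) max_card.
rewrite !card_prod card_bool !card_ord => /leq_trans; apply.
(* For J >= 1 the number 2(K + 1)(J + 1) of codes is at most 4KJ + 4J. *)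
have J_gt0 : (0 < J)%N by rewrite divn_gt0.
have KJ : (K * J <= X ^ 2 %/ p ^ 2)%N.
  rewrite leq_divRL //; apply: leq_trans (_ : X * M * J <= _)%N.
    by rewrite mulnAC leq_mul2r leq_trunc_div orbT.
  by rewrite -mulnn -mulnA leq_mul2l mulnC leq_trunc_div orbT.
nia.
Qed.

(** A class of minimal height above [Y] gets the uniform bound [X %/ Y]; otherwise the cost is
    charged to the minimal point itself, so that summing over g gives a sum over short pairs instead
    of a factor p. *)
Let class_card (g : 'F_p) :
  (#|class g| <= 4 * (X ^ 2 %/ p ^ 2) + 4 * (X %/ Y) +
    4 * \sum_(xy in class g | (height xy <= Y)%N) X %/ height xy)%N.
Proof.
have [->|[xy1 in1]] := set_0Vmem (class g); first by rewrite cards0.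
case: (arg_minnP height in1) => xy0 in0 min0.
apply: leq_trans (class_card_min in0 min0) _.
case: (leqP (height xy0) Y) => hY.
  rewrite (bigD1 xy0) /=; last by apply/andP.
    by nia.
have : (X %/ height xy0 <= X %/ Y)%N by apply: leq_div2l => //; apply: ltnW.
nia.
Qed.

(** The short pairs are bounded by all pairs of height at most [Y], whatever their quotients: about
    2h pairs have height h, each of weight [X %/ h], which gives 2XY in total and, with the factor 4
    of [class_card], the last term. *)
Lemma card_fq_pairs :
  (#|fq_pairs| <= 4 * p * (X ^ 2 %/ p ^ 2) + 4 * p * (X %/ Y) + 8 * X * Y)%N.
Proof.
rewrite -sum1_card (partition_big (fun xy : 'I_X * 'I_X => ratio p xy.1.+1 xy.2.+1) xpredT) //=.
apply: (@leq_trans (\sum_(g : 'F_p) (4 * (X ^ 2 %/ p ^ 2) + 4 * (X %/ Y) +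
    4 * \sum_(xy in class g | (height xy <= Y)%N) X %/ height xy))%N).
  apply: leq_sum => g _; apply: leq_trans (class_card g).
  by rewrite -sum1_card; apply: eq_leq; apply: eq_bigl => xy; rewrite [RHS]inE.
rewrite big_split /= sum_nat_const card_Fp // mulnDr !mulnA [(p * 4)%N]mulnC.
rewrite leq_add2l -big_distrr.
suff : (\sum_(g : 'F_p) \sum_(xy in class g | (height xy <= Y)%N) X %/ height xy <=
        2 * (X * Y))%N.
  by move=> H; apply: leq_trans (leq_mul (leqnn 4) H) _; lia.
have -> : (\sum_(g : 'F_p) \sum_(xy in class g | (height xy <= Y)%N) X %/ height xy =
  \sum_(xy in fq_pairs | (height xy <= Y)%N) X %/ height xy)%N.
  rewrite [RHS](partition_big (fun xy : 'I_X * 'I_X => ratio p xy.1.+1 xy.2.+1) xpredT) //=.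
  by apply: eq_bigr => g _; apply: eq_bigl => xy; rewrite [xy \in class g]inE andbAC.
apply: (@leq_trans (\sum_(xy : 'I_X * 'I_X)
   ((if (xy.1 < Y) && (xy.2 < xy.1.+1) then X %/ xy.1.+1 else 0) +
    (if (xy.2 < Y) && (xy.1 < xy.2.+1) then X %/ xy.2.+1 else 0)))%N).
  rewrite big_mkcond; apply: leq_sum => -[x y] _ /=.
  case: ifP => // /andP[_]; rewrite /height /= geq_max => /andP[-> ->] /=.
  rewrite !ltnS; case: (leqP y x) => H; first by rewrite (maxn_idPl _) ?ltnS // leq_addr.
  by rewrite (maxn_idPr _) ?ltnS ?(ltnW H).
have half : (\sum_(x < X) \sum_(y < X)
   (if (x < Y) && (y < x.+1) then X %/ x.+1 else 0) <= X * Y)%N.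
  rewrite mulnC; apply: (@leq_trans (\sum_(x < X | (x < Y)%N) X)%N); last first.
    by rewrite sum_nat_const leq_mul2r card_ord_lt orbT.
  rewrite [leqRHS]big_mkcond; apply: leq_sum => x _; case: ifP => _ /=; last by rewrite big1.
  rewrite -big_mkcond sum_nat_const; apply: leq_trans (leq_trunc_div X x.+1).
  by rewrite mulnC leq_mul2l (card_ord_lt X x.+1) orbT.
rewrite big_split /= mul2n -addnn; apply: leq_add.
  by rewrite -(pair_bigA _ (fun x y : 'I_X => if (x < Y) && (y < x.+1) then X %/ x.+1 else 0)%N).
rewrite -(pair_bigA _ (fun x y : 'I_X => if (y < Y) && (x < y.+1) then X %/ y.+1 else 0)%N) /=.
by rewrite exchange_big.
Qed.

End LatticeCount.

(** * Burgess' bound *)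

Lemma card_simple_fraction_roots (F : finFieldType) (I : finType) (e g : I -> F) (i0 : I) :
  e i0 != 0 -> (forall j, j != i0 -> g j != g i0) ->
  leq #|[set x : F | [forall i, x + g i != 0] && (\sum_i e i / (x + g i) == 0)]| #|I|.
Proof.
move=> e0 g0; set A := [set _ | _].
(* The numerator; it does not vanish at the pole - g i0. *)
pose P := \sum_i e i *: \prod_(j | j != i) ('X - (- g j)%:P).
have PE x : P.[x] = \sum_i e i * \prod_(j | j != i) (x + g j).
  rewrite /P horner_sum; apply: eq_bigr => i _; rewrite hornerZ horner_prod.
  by congr (_ * _); apply: eq_bigr => j _; rewrite hornerXsubC opprK.
have P_neq0 : P != 0.
  apply: contraTneq isT => P0; have := PE (- g i0); rewrite P0 horner0.
  rewrite (bigD1 i0) //= [X in _ + X]big1 ?addr0 => [/esym/eqP|i ne]; last first.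
    by rewrite (bigD1 i0) 1?eq_sym //= addrC subrr mul0r mulr0.
  rewrite mulf_eq0 (negPf e0) /= => /prodf_eq0[j ne].
  by rewrite addrC subr_eq0 (negPf (g0 _ ne)).
have sizeP : (size P <= #|I|)%N.
  apply: leq_trans (size_sum _ _ _) _; apply/bigmax_leqP => i _.
  apply: leq_trans (size_scale_leq _ _) _.
  rewrite -big_enum size_prod_XsubC -cardE (cardC1 i) prednK //.
  by apply/card_gt0P; exists i.
apply: ltnW; apply: leq_trans _ sizeP; rewrite cardE.
apply: max_poly_roots => //; last exact: enum_uniq.
apply/allP => x; rewrite mem_enum inE => /andP[/forallP nz /eqP S0].
rewrite rootE.
suff -> : P.[x] = (\prod_i (x + g i)) * \sum_i e i / (x + g i) by rewrite S0 mulr0.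
rewrite PE mulr_sumr; apply: eq_bigr => i _; rewrite [in RHS](bigD1 i) //= mulrCA; congr (_ * _).
by rewrite mulrAC divff // mul1r.
Qed.

(** Every value is taken at least twice, so there are at most r values and f factors through ['I_r].
    These are the tuples of shifts without an isolated pole, the diagonal of Burgess' moment. *)
Lemma card_paired_ffun (I J : finType) (i0 : I) (r : nat) : (#|I| <= 2 * r)%N ->
  (#|[set f : {ffun I -> J} | [forall i, exists j, (j != i) && (f j == f i)]]| <=
   r ^ #|I| * #|J| ^ r)%N.
Proof.
move=> Ir; set A := [set _ | _].
have [->|[f0 _]] := set_0Vmem A; first by rewrite cards0.
have I_gt0 : (0 < #|I|)%N by apply/card_gt0P; exists i0.
case: r Ir => [|r] Ir; first by rewrite muln0 leqNgt I_gt0 in Ir.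
pose app (gh : {ffun 'I_r.+1 -> J} * {ffun I -> 'I_r.+1}) := [ffun i => gh.1 (gh.2 i)].
suff sub : A \subset [set app gh | gh in setT].
  apply: leq_trans (subset_leq_card sub) _; apply: leq_trans (leq_imset_card _ _) _.
  by rewrite cardsT card_prod !card_ffun !card_ord mulnC.
apply/subsetP => f; rewrite inE => /forallP fA.
pose C := [set f i | i in I].
have Cr : (#|C| <= r.+1)%N.
  rewrite -(leq_pmul2l (ltn0Sn 1)); apply: leq_trans Ir.
  rewrite mulnC -sum_nat_const -sum1_card (partition_big f [in C]) => [|i _]; last exact: imset_f.
  apply: leq_sum => _ /imsetP[i _ ->]; rewrite sum1dep_card.
  have /existsP[j /andP[ji /eqP fji]] := fA i.
  by apply/card_gt1P; exists j, i; rewrite !inE ?fji ?eqxx.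
have idx i : (index (f i) (enum C) < r.+1)%N.
  by apply: leq_trans Cr; rewrite cardE index_mem mem_enum imset_f.
apply/imsetP; exists ([ffun k : 'I_r.+1 => nth (f0 i0) (enum C) k],
  [ffun i => Ordinal (idx i)]) => //.
by apply/ffunP => i; rewrite !ffunE /= nth_index // mem_enum imset_f.
Qed.

Section Burgess.

Variable p : nat.
Hypothesis p_pr : prime p.
Local Notation ec := (ec p_pr).

Definition chi (c : 'F_p) (x : nat) : algC := if coprime x p then ec (c * fq p x) else 0.

Lemma chiM (c : 'F_p) (x y : nat) : chi c (x * y) = chi c x * chi c y.
Proof.
rewrite /chi coprimeMl; case cx: (coprime x p); case cy: (coprime y p) => /=;
  rewrite ?mulr0 ?mul0r //.
by rewrite fqM // mulrDr ecD.
Qed.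

Lemma conj_chi (c : 'F_p) (x : nat) : (chi c x)^* = chi (- c) x.
Proof. by rewrite /chi; case: ifP => _; rewrite ?rmorph0 // conj_ec mulNr. Qed.

Lemma norm_chi_le1 (c : 'F_p) (x : nat) : `|chi c x| <= 1.
Proof. by rewrite /chi; case: ifP => _; rewrite ?normr0 // norm_ec. Qed.

Lemma norm_chi (c : 'F_p) (x : nat) : coprime x p -> `|chi c x| = 1.
Proof. by move=> cx; rewrite /chi cx norm_ec. Qed.

Lemma chi_eqmod (c : 'F_p) (x y : nat) : x = y %[mod p ^ 2] -> chi c x = chi c y.
Proof.
move=> xy; have E t : ((t %% p ^ 2)%N = t %[mod p])%N by rewrite modn_dvdm // dvdn_exp.
have cxy : coprime x p = coprime y p by rewrite -coprime_modl -E xy E coprime_modl.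
rewrite /chi -cxy; case: ifP => // cx; by rewrite (fq_eqmod p_pr cx xy).
Qed.

Lemma chiDp (c : 'F_p) (x k : nat) :
  chi c (x + p * k) = chi c x * ec (- (k%:R * (c / x%:R))).
Proof.
rewrite /chi coprimenDp; case: ifP => cx; last by rewrite mul0r.
by rewrite fqDp // -ecD; congr ec; ring.
Qed.

(* Residues modulo p^2 are encoded by their two base-p digits. *)
Definition plift (xk : 'F_p * 'F_p) : nat := (xk.1 + p * xk.2)%N.

(** The factors of the 2r-th power are indexed by [bool * 'I_r]; the boolean marks the conjugated
    ones, and conjugation negates c by [conj_chi]. *)
Let sgc (c : 'F_p) (s : bool) : 'F_p := if s then c else - c.

(** By [chiDp] and orthogonality the sum over the upper digit k vanishes unless [slope f x = 0].
    Paired tuples f are bounded trivially by p^2 each, giving the first term; a tuple with an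
    isolated shift, a simple pole since [B <= p], leaves at most 2r lower digits x, giving the
    second. *)
Lemma chi_moment (c : 'F_p) (B r : nat) : c != 0 -> (B <= p)%N -> (0 < r)%N ->
  \sum_xk `|\sum_(b < B) chi c (plift xk + b)| ^+ (2 * r) <=
  (r ^ (2 * r) * B ^ r * p ^ 2 + 2 * r * B ^ (2 * r) * p)%:R.
Proof.
move=> c0 Bp r_gt0.
pose I : finType := (bool * 'I_r)%type.
have cardI : #|I| = (2 * r)%N by rewrite card_prod card_bool card_ord.
pose term (f : {ffun I -> 'I_B}) xk := \prod_(i : I) chi (sgc c i.1) (plift xk + f i).
have expand xk : `|\sum_(b < B) chi c (plift xk + b)| ^+ (2 * r) = \sum_f term f xk.
  rewrite exprM normCK rmorph_sum exprMn.
  under [X in _ * X ^+ r]eq_bigr do rewrite /= conj_chi.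
  rewrite /term -(bigA_distr_bigA (fun (i : I) (b : 'I_B) => chi (sgc c i.1) (plift xk + b))).
  rewrite -(pair_bigA _ (fun (s : bool) (i : 'I_r) => \sum_(b < B) chi (sgc c s) (plift xk + b))) /=.
  rewrite big_bool /= !prodr_const !card_ord //.
under eq_bigr do rewrite expand.
rewrite exchange_big /=.
pose slope (f : {ffun I -> 'I_B}) (x : 'F_p) := \sum_(i : I) sgc c i.1 / (x + (f i)%:R).
pose roots (f : {ffun I -> 'I_B}) := [set x : 'F_p | [forall i, x + (f i)%:R != 0] && (slope f x == 0)].
have inner f : `|\sum_xk term f xk| <= (p * #|roots f|)%:R.
  rewrite -(pair_bigA _ (fun x k => term f (x, k))) /=.
  apply: le_trans (ler_norm_sum _ _ _) _.
  rewrite natrM -sum1_card natr_sum mulr_sumr [leRHS]big_mkcond; apply: ler_sum => x _.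
  have -> : \sum_k term f (x, k) =
      \prod_(i : I) chi (sgc c i.1) (x + f i) * (if slope f x == 0 then p%:R else 0).
    rewrite -(oppr_eq0 (slope f x)) -(sum_ec p_pr) mulr_sumr; apply: eq_bigr => k _.
    rewrite /term (eq_bigr (fun i : I => chi (sgc c i.1) (x + f i) *
      ec (- (k * (sgc c i.1 / (x + (f i)%:R)))))) => [|i _]; last first.
      rewrite /plift /= addnAC chiDp natr_Zp; congr (_ * ec (- (_ * (_ / _)))).
      by rewrite natrD natr_Zp.
    by rewrite big_split /= -ec_sum -sumrN mulr_sumr; congr (_ * ec _); apply: eq_bigr => i _; rewrite mulrN.
  rewrite inE normrM normr_prod.
  have [nz|/forallPn[i]] := boolP [forall i, x + (f i)%:R != 0].
    case: ifP => _; rewrite ?normr0 ?mulr0 // mulr1 normr_nat.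
    rewrite -[leRHS]mul1r; apply: ler_wpM2r; first exact: ler0n.
    by apply: prodr_ile1 => i _; rewrite normr_ge0 norm_chi_le1.
  rewrite negbK -{1}(natr_Zp x) -natrD natFp_eq0 // => dvd.
  have -> : \prod_(i : I) `|chi (sgc c i.1) (x + f i)| = 0.
    apply/eqP/prodf_eq0; exists i => //; rewrite normr_eq0 /chi ifN //.
    by rewrite coprime_sym prime_coprime // negbK.
  by rewrite mul0r.
set bad := [set f : {ffun I -> 'I_B} | [forall i, exists j, (j != i) && (f j == f i)]].
have roots_good f : f \notin bad -> (#|roots f| <= 2 * r)%N.
  rewrite inE negb_forall => /existsP[i0]; rewrite negb_exists => /forallP uniq0.
  rewrite -cardI; apply: (@card_simple_fraction_roots _ _ _ _ i0).
    by rewrite /sgc; case: ifP => _; rewrite ?oppr_eq0.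
  move=> j ji0; have := uniq0 j; rewrite ji0 /=; apply: contraNN.
  rewrite natFp_eqmod // !modn_small //; try exact: leq_trans (ltn_ord _) Bp.
have roots_le f : (#|roots f| <= p)%N by rewrite (leq_trans (max_card _)) ?card_Fp.
rewrite -[leLHS]ger0_norm; last first.
  rewrite exchange_big /=; apply: sumr_ge0 => xk _; rewrite -expand.
  exact: exprn_ge0.
apply: le_trans (ler_norm_sum _ _ _) _.
apply: (@le_trans _ _ (\sum_f (p * #|roots f|)%:R)); first by apply: ler_sum => f _; apply: inner.
rewrite -natr_sum ler_nat (bigID [in bad]) /=; apply: leq_add.
  apply: (@leq_trans (\sum_(f in bad) (p ^ 2))%N).
    by apply: leq_sum => f _; rewrite -mulnn leq_mul2l roots_le orbT.
  rewrite sum_nat_const leq_mul2r; apply/orP; right.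
  have := card_paired_ffun 'I_B (false, Ordinal r_gt0) (eq_leq cardI).
  by rewrite cardI card_ord.
apply: (@leq_trans (\sum_(f : {ffun I -> 'I_B}) (p * (2 * r)))%N).
  rewrite big_mkcond; apply: leq_sum => f _; case: ifP => // fb.
  by rewrite leq_mul2l roots_good ?orbT.
by rewrite sum_nat_const card_ffun card_ord cardI; nia.
Qed.

End Burgess.

(** * From complete moments to incomplete sums *)

Section BurgessBound.

Variables (p : nat) (N A B r D : nat).
Hypotheses (p_pr : prime p) (NAB : (N + A * B < p)%N) (NA : (N * A < p ^ 2)%N).
Hypotheses (A_gt0 : (0 < A)%N) (B_gt0 : (0 < B)%N) (Bp : (B <= p)%N) (r_gt0 : (0 < r)%N).
Hypothesis tauD : forall x, (0 < x <= N * A)%N -> (size (divisors x) <= D)%N.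

Local Notation chi := (chi p_pr).

Lemma norm_sum_chi_shift (c : 'F_p) (h : nat) :
  `|\sum_(n < N) chi c n.+1 - \sum_(n < N) chi c (n.+1 + h)| <= (2 * h)%:R.
Proof.
pose F h := \sum_(n < N) chi c (n.+1 + h).
rewrite -[X in _ - X]/(F h); elim: h => [|h IHh].
  by rewrite /F; under [X in _ - X]eq_bigr do rewrite addn0; rewrite subrr normr0.
apply: le_trans (ler_distD (F h) _ _) _.
rewrite mulnS addnC natrD; apply: lerD => //.
rewrite /F -sumrB -(big_mkord xpredT (fun n => chi c (n.+1 + h) - chi c (n.+1 + h.+1))).
rewrite (eq_bigr (fun n => - (chi c (n.+1 + h.+1) - chi c (n + h.+1)))) => [|n _]; last first.
  by rewrite opprB addSnnS.
rewrite sumrN (telescope_sumr (fun n => chi c (n + h.+1))) //.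
rewrite normrN; apply: le_trans (ler_normB _ _) _.
by rewrite -(natr1 1) lerD ?norm_chi_le1.
Qed.

Lemma plift_mod (x : nat) :
  (plift (x%:R : 'F_p, (x %/ p)%:R : 'F_p) = x %[mod p ^ 2])%N.
Proof.
rewrite /plift !val_Fp_nat // [in RHS](divn_eq x p) [in RHS](divn_eq (x %/ p) p).
by rewrite mulnDl -mulnA mulnn -addnA modnMDl addnC mulnC.
Qed.

(* n / a modulo p^2, the inverse of a being a power of a. *)
Let quo (na : 'I_N * 'I_A) : 'F_p * 'F_p :=
  let x := (na.1.+1 * na.2.+1 ^ (totient (p ^ 2)).-1)%N in (x%:R, (x %/ p)%:R).

Let A_lt_p : (A < p)%N.
Proof. by apply: leq_ltn_trans NAB; rewrite -[leqLHS]addn0; nia. Qed.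

Let coprime_a (a : 'I_A) : coprime a.+1 p.
Proof. by apply: small_coprime => //=; apply: leq_ltn_trans A_lt_p. Qed.

Let quoP (na : 'I_N * 'I_A) : (na.2.+1 * plift (quo na) = na.1.+1 %[mod p ^ 2])%N.
Proof.
have ca2 : coprime na.2.+1 (p ^ 2) by rewrite coprimeXr.
rewrite -modnMmr plift_mod modnMmr mulnCA -expnS prednK ?totient_gt0 ?expn_gt0 ?prime_gt0 //.
by rewrite -modnMmr cyclic.Euler_exp_totient // modnMmr muln1.
Qed.

Let wt (c : 'F_p) (xk : 'F_p * 'F_p) := `|\sum_(b < B) chi c (plift xk + b)|.

Let wt_shift (c : 'F_p) (na : 'I_N * 'I_A) :
  `|\sum_(b < B) chi c (na.1.+1 + na.2.+1 * b)| = wt c (quo na).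
Proof.
rewrite /wt -[RHS]mul1r -(norm_chi p_pr c (coprime_a na.2)) -normrM mulr_sumr.
congr `|_|; apply: eq_bigr => b _; rewrite -chiM; apply: chi_eqmod.
by rewrite mulnDr -[RHS]modnDml quoP modnDml.
Qed.

(** As NA < p^2, equal quotients n/a and n'/a' modulo p^2 give na' = n'a in integers. Then a divides
    na', leaving at most D choices once n and a' are given, and n' follows. *)
Let card_quo_eq : (#|[set t : ('I_N * 'I_A) * ('I_N * 'I_A) | quo t.1 == quo t.2]| <= N * A * D)%N.
Proof.
set Q := [set _ | _].
have Q_eq t : t \in Q -> (t.1.1.+1 * t.2.2.+1 = t.2.1.+1 * t.1.2.+1)%N.
  rewrite inE => /eqP q.
  have : (t.1.1.+1 * t.2.2.+1 = t.2.1.+1 * t.1.2.+1 %[mod p ^ 2])%N.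
    rewrite -[LHS]modnMml -quoP modnMml -[RHS]modnMml -quoP modnMml q.
    by congr (_ %% _)%N; ring.
  by rewrite !modn_small //; apply: leq_ltn_trans NA; apply: leq_mul.
pose phi (t : ('I_N * 'I_A) * ('I_N * 'I_A)) := ((t.1.1, t.2.2), t.1.2).
have phi_inj : {in Q &, injective phi}.
  move=> [[n a] [n' a']] [[m b] [m' b']] /Q_eq /= E1 /Q_eq /= E2 [nm ab ab'].
  subst m b b'; have /eqP : (n'.+1 * a.+1 = m'.+1 * a.+1)%N by rewrite -E1 -E2.
  by rewrite eqn_pmul2r // => /eqP/succn_inj/val_inj->.
rewrite -(card_in_imset phi_inj).
pose R := [set z : ('I_N * 'I_A) * 'I_A | (z.2.+1 %| z.1.1.+1 * z.1.2.+1)%N].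
apply: leq_trans (_ : #|R| <= _)%N.
  apply/subset_leq_card/subsetP => _ /imsetP[t /Q_eq E ->].
  by rewrite inE /= E dvdn_mull.
rewrite -sum1dep_card -(pair_big_dep xpredT
  (fun (na : 'I_N * 'I_A) (a : 'I_A) => (a.+1 %| na.1.+1 * na.2.+1)%N) (fun _ _ => 1%N)) /=.
apply: (@leq_trans (\sum_(na : 'I_N * 'I_A) D)%N); last first.
  by rewrite sum_nat_const card_prod !card_ord.
apply: leq_sum => na _; rewrite sum1dep_card.
apply: (@leq_trans (size (divisors (na.1.+1 * na.2.+1)))); last first.
  by apply: tauD; rewrite muln_gt0 /= leq_mul.
rewrite cardE -(size_map (fun a : 'I_A => a.+1)); apply: uniq_leq_size.
  by rewrite map_inj_uniq ?enum_uniq // => a a' /succn_inj/val_inj.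
by move=> d /mapP[a]; rewrite mem_enum inE => dvd ->; rewrite -dvdn_divisors ?muln_gt0.
Qed.

(** The power mean raises [wt] to the power r, and Cauchy's inequality separates it from the
    multiplicities [nu] of the quotients, whose second moment is [card_quo_eq]. The other factor is
    the complete moment. *)
Let sum_wt_le (c : 'F_p) : c != 0 ->
  (\sum_na wt c (quo na)) ^+ (2 * r) <=
  ((N * A) ^ (2 * r.-1) * (N * A * D) *
   (r ^ (2 * r) * B ^ r * p ^ 2 + 2 * r * B ^ (2 * r) * p))%:R.
Proof.
move=> c0; have wt0 xk : 0 <= wt c xk by apply: normr_ge0.
pose nu xk : nat := #|[set na | quo na == xk]|.
have nuE (f : 'F_p * 'F_p -> algC) : \sum_na f (quo na) = \sum_xk (nu xk)%:R * f xk.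
  rewrite (partition_big quo xpredT) //=; apply: eq_bigr => xk _.
  rewrite (eq_bigr (fun=> f xk)) => [|na /eqP-> //].
  by rewrite sumr_const mulr_natl; congr (_ *+ _); apply: eq_card => na; rewrite inE.
have nu2 : \sum_xk (nu xk)%:R ^+ 2 <= (N * A * D)%:R :> algC.
  under eq_bigr do rewrite expr2.
  rewrite -(nuE (fun xk => (nu xk)%:R)) -natr_sum ler_nat; apply: leq_trans card_quo_eq.
  rewrite -sum1dep_card -(pair_big_dep xpredT (fun na na' => quo na == quo na') (fun _ _ => 1%N)) /=.
  apply: leq_sum => na _; rewrite sum1dep_card; apply: subset_leq_card.
  by apply/subsetP => na'; rewrite !inE eq_sym.
have mean : (\sum_na wt c (quo na)) ^+ r <= (N * A)%:R ^+ r.-1 * \sum_na wt c (quo na) ^+ r.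
  have := power_mean r.-1 (fun _ : 'I_N * 'I_A => ler01) (fun na => wt0 (quo na)).
  rewrite prednK // sumr_const card_prod !card_ord.
  by under eq_bigr do rewrite mul1r; under [X in _ <= _ * X]eq_bigr do rewrite mul1r.
have cauchy : (\sum_na wt c (quo na) ^+ r) ^+ 2 <=
    (N * A * D)%:R * \sum_xk wt c xk ^+ (2 * r).
  rewrite (nuE (fun xk => wt c xk ^+ r)).
  have := holder_pow 1 (fun xk : 'F_p * 'F_p => ler0n algC (nu xk))
    (fun xk => exprn_ge0 r (wt0 xk)).
  rewrite expr1; under eq_bigr do rewrite expr1.
  move=> /le_trans; apply.
  under [X in _ * X <= _]eq_bigr do rewrite -exprM mulnC.
  by apply: ler_wpM2r => //; apply: sumr_ge0 => xk _; apply: exprn_ge0.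
rewrite [in leLHS]mulnC exprM.
have S0 : 0 <= \sum_na wt c (quo na) by apply: sumr_ge0.
have S0r : 0 <= \sum_na wt c (quo na) ^+ r by apply: sumr_ge0 => na _; apply: exprn_ge0.
have NA0 : 0 <= (N * A)%:R ^+ r.-1 :> algC by rewrite exprn_ge0 ?ler0n.
apply: le_trans (_ : ((N * A)%:R ^+ r.-1 * \sum_na wt c (quo na) ^+ r) ^+ 2 <= _).
  by rewrite lerXn2r ?nnegrE ?exprn_ge0 ?mulr_ge0.
rewrite exprMn -exprM [(r.-1 * 2)%N]mulnC -mulnA [leRHS]natrM natrX.
apply: ler_wpM2l; first by rewrite exprn_ge0 ?ler0n.
apply: le_trans cauchy _; rewrite [leRHS]natrM; apply: ler_wpM2l; first exact: ler0n.
exact: chi_moment.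
Qed.

Lemma exprD_le (F : numDomainType) (x y : F) (k : nat) : 0 <= x -> 0 <= y ->
  (x + y) ^+ k <= 2 ^+ k * (x ^+ k + y ^+ k).
Proof.
wlog le : x y / x <= y => [H x0 y0|x0 y0].
  have [le|/ltW le] := real_leP (ger0_real x0) (ger0_real y0); first exact: H.
  by rewrite addrC [X in _ * X]addrC; apply: H.
apply: (@le_trans _ _ ((2 * y) ^+ k)).
  by rewrite lerXn2r ?nnegrE ?addr_ge0 ?mulr_ge0 // mulr_natl mulr2n lerD2r.
by rewrite exprMn ler_wpM2l ?exprn_ge0 // lerDr exprn_ge0.
Qed.

(** Average over the shifts n + ab = a(n/a + b). The condition [p <= B ^ r] makes the diagonal of
    [chi_moment] no larger than the other term, the condition on [N * A] gives the saving [z] in T,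
    and [A * B * z <= N] gives it in the shift error. The constant comes from 2^(2r) (1 + 2^(2r)) <=
    32^r. *)
Lemma burgess_bound (c : 'F_p) (z : nat) : c != 0 -> (p <= B ^ r)%N ->
  (z * (D * (r ^ (2 * r) + 2 * r) * p) <= N * A)%N -> (A * B * z <= N)%N ->
  `|\sum_(n < N) chi c n.+1| ^+ (2 * r) * z%:R <= (32 ^ r * N ^ (2 * r))%:R.
Proof.
move=> c0 pB zNA ABz; set S := `|_|; set T := \sum_na wt c (quo na).
have S_le : (A * B)%:R * S <= T + (2 * (A * B) ^ 2)%:R.
  pose G (ab : 'I_A * 'I_B) := \sum_(n < N) chi c (n.+1 + ab.1.+1 * ab.2).
  have TG : `|\sum_ab G ab| <= T.
    rewrite /G exchange_big /= /T -(pair_bigA _ (fun n a => wt c (quo (n, a)))) /=.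
    apply: le_trans (ler_norm_sum _ _ _) (ler_sum _ _) => n _.
    rewrite -(pair_bigA _ (fun (a : 'I_A) (b : 'I_B) => chi c (n.+1 + a.+1 * b))) /=.
    apply: le_trans (ler_norm_sum _ _ _) (ler_sum _ _) => a _.
    by rewrite -wt_shift.
  have err : `|\sum_(ab : 'I_A * 'I_B) (\sum_(n < N) chi c n.+1 - G ab)| <= (2 * (A * B) ^ 2)%:R.
    apply: le_trans (ler_norm_sum _ _ _) _.
    apply: (@le_trans _ _ (\sum_(ab : 'I_A * 'I_B) (2 * (A * B))%:R)).
      apply: ler_sum => ab _; apply: le_trans (norm_sum_chi_shift c (ab.1.+1 * ab.2)) _.
      by rewrite ler_nat leq_mul2l leq_mul // ltnW.
    by rewrite sumr_const card_prod !card_ord -mulrnA ler_nat -mulnn -mulnA.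
  have -> : (A * B)%:R * S = `|\sum_(ab : 'I_A * 'I_B) \sum_(n < N) chi c n.+1|.
    by rewrite sumr_const card_prod !card_ord normrMn mulr_natl.
  rewrite -(subrK (\sum_ab G ab) (\sum_(ab : 'I_A * 'I_B) _)) -sumrB addrC.
  by apply: le_trans (ler_normD _ _) (lerD TG err).
have T0 : 0 <= T by apply: sumr_ge0 => na _; apply: normr_ge0.
have Tz : T ^+ (2 * r) * z%:R <= ((N * (A * B)) ^ (2 * r))%:R.
  apply: le_trans (ler_wpM2r (ler0n _ z) (sum_wt_le c0)) _.
  rewrite -natrM ler_nat.
  have r2 : (2 * r = (2 * r.-1).+2)%N by lia.
  have Bp' : (r ^ (2 * r) * B ^ r * p ^ 2 + 2 * r * B ^ (2 * r) * p <=
    (r ^ (2 * r) + 2 * r) * p * B ^ (2 * r))%N.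
    have -> : (B ^ (2 * r) = B ^ r * B ^ r)%N by rewrite -expnD; congr (_ ^ _)%N; lia.
    by move: (B ^ r)%N (r ^ (2 * r))%N pB => b q pb; rewrite -mulnn; nia.
  apply: (@leq_trans ((N * A) ^ (2 * r.-1) * (N * A * D) * ((r ^ (2 * r) + 2 * r) * p * B ^ (2 * r)) * z)%N).
    by rewrite leq_mul2r leq_mul2l Bp' !orbT.
  have -> : ((N * (A * B)) ^ (2 * r) = (N * A) ^ (2 * r.-1) * (N * A) * B ^ (2 * r) * (N * A))%N.
    by rewrite mulnA expnMn {1}r2 2!expnS; ring.
  have -> : ((N * A) ^ (2 * r.-1) * (N * A * D) * ((r ^ (2 * r) + 2 * r) * p * B ^ (2 * r)) * z =
    (N * A) ^ (2 * r.-1) * (N * A) * B ^ (2 * r) * (z * (D * (r ^ (2 * r) + 2 * r) * p)))%N by ring.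
  exact: leq_mul.
have AB_gt0 : (0 < A * B)%N by rewrite muln_gt0 A_gt0.
have ABr0 : 0 < (A * B)%:R ^+ (2 * r) :> algC by rewrite exprn_gt0 ?ltr0n.
rewrite -(ler_pM2l ABr0) mulrA -exprMn.
apply: (@le_trans _ _ ((T + (2 * (A * B) ^ 2)%:R) ^+ (2 * r) * z%:R)).
  apply: ler_wpM2r; first exact: ler0n.
  by apply: lerXn2r => //; rewrite nnegrE ?mulr_ge0 ?addr_ge0 ?ler0n ?normr_ge0.
apply: le_trans (ler_wpM2r (ler0n _ z) (exprD_le _ T0 (ler0n _ _))) _.
rewrite -mulrA mulrDl mulrDr.
apply: (@le_trans _ _ ((2 ^ (2 * r) * (N * (A * B)) ^ (2 * r))%:R +
   (2 ^ (2 * r) * ((2 * (A * B) * N) ^ (2 * r)))%:R)).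
  apply: lerD; rewrite [leRHS]natrM [X in _ <= X * _]natrX ler_wpM2l ?exprn_ge0 //.
  rewrite -natrX -natrM ler_nat.
  have -> : (2 * (A * B) ^ 2 = (2 * (A * B)) * (A * B))%N by rewrite -mulnn; ring.
  rewrite expnMn -mulnA [leqRHS]expnMn leq_mul2l; apply/orP; right.
  apply: leq_trans (leq_exp2r_w (2 * r) ABz); rewrite [leqRHS]expnMn leq_mul2l; apply/orP; right.
  by case: (z) => // z1; rewrite -[leqLHS]expn1 leq_pexp2l //; lia.
rewrite -natrD -natrX -natrM ler_nat.
have -> : (32 ^ r = 2 ^ (2 * r) * (2 ^ (2 * r) * 2 ^ r))%N.
  by rewrite -!expnD (_ : 32 = 2 ^ 5)%N // -expnM; congr (_ ^ _)%N; lia.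
have two : (2 <= 2 ^ r)%N by rewrite -{1}(expn1 2) leq_exp2l.
have one : (0 < 2 ^ (2 * r))%N by rewrite expn_gt0.
rewrite (expnMn N) (expnMn (2 * (A * B))) (expnMn 2).
move: ((A * B) ^ (2 * r))%N (N ^ (2 * r))%N (2 ^ (2 * r))%N (2 ^ r)%N two one => x y t u tw on.
nia.
Qed.

End BurgessBound.

(** * Chebyshev and Mertens *)

Lemma prod_primes_dvd (s : seq nat) (n : nat) : uniq s -> all prime s ->
  (forall q, q \in s -> q %| n)%N -> (\prod_(q <- s) q %| n)%N.
Proof.
elim: s => [|q s IHs] /=; first by rewrite big_nil.
move=> /andP[qs us] /andP[q_pr s_pr] dvd; rewrite big_cons Gauss_dvd.
  rewrite dvd ?mem_head //=; apply: IHs => // t ts; apply: dvd.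
  by rewrite inE ts orbT.
rewrite prime_coprime //; apply: contra qs.
elim: s s_pr {us IHs dvd} => [|t s IHs] /=; first by rewrite big_nil dvdn1 => _ /eqP q1; rewrite q1 in q_pr.
move=> /andP[t_pr s_pr]; rewrite big_cons Euclid_dvdM // inE => /orP[|/IHs-> //].
  by rewrite dvdn_prime2 // => ->.
by rewrite orbT.
Qed.

(** Erdos' argument: for n = 2k + 1 the primes in (k + 1, 2k + 1] divide the binomial coefficient of
    2k + 1 over k, which occurs twice in the expansion of 2^(2k+1) and so is at most 4^k. *)
Lemma primorial_le (n : nat) : (\prod_(0 <= q < n.+1 | prime q) q <= 4 ^ n)%N.
Proof.
have [m] := ubnP n; elim: m n => // m IHm n lt_nm.
case: n lt_nm => [|[|[|n]]] lt_nm.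
- by rewrite big_mkcond /= big_nat1.
- by rewrite big_mkcond /= big_nat_recr //= big_nat1.
- by rewrite big_mkcond /= !big_nat_recr //= big_geq.
case: (boolP (odd n.+3)) => [odd_n|even_n]; last first.
  rewrite big_mkcond /= big_nat_recr //= -big_mkcond ifN.
    by rewrite muln1 (leq_trans (IHm _ _)) // leq_exp2l.
  apply: contra even_n => pr; have [p2|//] := even_prime pr.
  by move: p2; rewrite /= .
set k := n.+3./2; have nE : n.+3 = (k.*2).+1.
  by rewrite -[LHS]odd_double_half odd_n.
have k_gt0 : (0 < k)%N by move: nE; rewrite -muln2; lia.
rewrite nE (@big_cat_nat _ _ _ k.+2) //=; last by rewrite -muln2; lia.
have -> : (4 ^ k.*2.+1 = 4 ^ k.+1 * 4 ^ k)%N by rewrite -expnD; congr (_ ^ _)%N; rewrite -muln2; lia.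
apply: leq_mul; first by apply: IHm; move: lt_nm; rewrite nE -muln2; lia.
have bin_le : ('C(k.*2.+1, k) <= 4 ^ k)%N.
  have tot : (\sum_(i < k.*2.+2) 'C(k.*2.+1, i) = 2 ^ k.*2.+1)%N.
    by have := expnDn 1 1 k.*2.+1; rewrite addn1 => ->; apply: eq_bigr => i _; rewrite !exp1n !muln1.
  have kk : (k < k.*2.+2)%N by rewrite -muln2; lia.
  have kk1 : (k.+1 < k.*2.+2)%N by rewrite -muln2; lia.
  have : ('C(k.*2.+1, k) + 'C(k.*2.+1, k.+1) <= 2 ^ k.*2.+1)%N.
    rewrite -tot (bigD1 (Ordinal kk)) //= (bigD1 (Ordinal kk1)) /=; first by rewrite addnA leq_addr.
    by rewrite -val_eqE /= neq_ltn ltnS leqnn orbT.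
  have -> : ('C(k.*2.+1, k.+1) = 'C(k.*2.+1, k))%N.
    have kE : (k.*2.+1 - k = k.+1)%N by rewrite -muln2; lia.
    by rewrite -[RHS]bin_sub ?kE // -muln2; lia.
  rewrite addnn -mul2n expnS leq_pmul2l // -muln2 mulnC expnM //.
apply: leq_trans bin_le; apply: dvdn_leq; first by rewrite bin_gt0 -muln2; lia.
rewrite -big_filter; apply: prod_primes_dvd.
- by rewrite filter_uniq ?iota_uniq.
- exact: filter_all.
move=> q; rewrite mem_filter mem_index_iota => /andP[q_pr /andP[kq qk]].
have := bin_fact (_ : k <= k.*2.+1)%N; rewrite -muln2 => /(_ _)/esym binE.
have fact_dvd : (q %| (k * 2).+1`!)%N by rewrite dvdn_fact // prime_gt0 //= muln2.
rewrite binE in fact_dvd; last by lia.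
have ndvd j : (j < q)%N -> ~~ (q %| j`!)%N.
  elim: j => [|j IHj] jq; first by rewrite fact0 dvdn1 neq_ltn prime_gt1 ?orbT.
  rewrite factS Euclid_dvdM // negb_or IHj 1?ltnW // andbT.
  by rewrite gtnNdvd.
move: fact_dvd; rewrite Euclid_dvdM // Euclid_dvdM // => /orP[//|/orP[]] H.
  by rewrite (negPf (ndvd k _)) // in H; lia.
by rewrite (negPf (ndvd _ _)) // in H; lia.
Qed.

Section Mertens.

Variable R : realType.
Implicit Types (n m q : nat).

Lemma ln_prod (s : seq nat) (P : pred nat) (F : nat -> nat) :
  (forall q, P q -> (0 < F q)%N) ->
  ln ((\prod_(q <- s | P q) F q)%N%:R : R) = \sum_(q <- s | P q) ln (F q)%:R.
Proof.
move=> F_gt0; elim: s => [|q s IHs]; first by rewrite !big_nil ln1.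
rewrite !big_cons; case: ifP => // Pq; rewrite natrM lnM ?IHs // posrE ltr0n ?F_gt0 //.
exact: prodn_cond_gt0.
Qed.

Lemma ln_nat_ge0 n : 0 <= ln n%:R :> R.
Proof. by case: n => [|n]; [rewrite ln0 | rewrite ln_ge0 // ler1n]. Qed.

Lemma theta_le n : \sum_(0 <= q < n.+1 | prime q) ln q%:R <= n%:R * 4 :> R.
Proof.
rewrite -(@ln_prod _ _ (fun q => q)) => [|q]; last exact: prime_gt0.
have P_gt0 : (0 < \prod_(0 <= q < n.+1 | prime q) q)%N.
  by apply: prodn_cond_gt0 => q /prime_gt0.
apply: (@le_trans _ _ (ln (4 ^ n)%:R)).
  by rewrite ler_ln ?posrE ?ltr0n ?expn_gt0 // ler_nat primorial_le.
by rewrite natrX lnXn // [leRHS]mulr_natl ler_wMn2r // ltW // ln_sublinear.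
Qed.

Lemma ln_fact n :
  ln n`!%:R = \sum_(0 <= q < n.+1 | prime q) (logn q n`!)%:R * ln q%:R :> R.
Proof.
have {1}-> : n`! = (\prod_(0 <= q < n.+1 | prime q) q ^ logn q n`!)%N.
  rewrite {1}[n`!]prod_prime_decomp ?fact_gt0 // prime_decompE big_map /=.
  rewrite -[in RHS]big_filter; apply: perm_big; apply: uniq_perm.
  - exact: primes_uniq.
  - by rewrite filter_uniq ?iota_uniq.
  move=> q; rewrite mem_primes mem_filter mem_index_iota fact_gt0 /=.
  case q_pr: (prime q) => //=.
  apply/idP/idP => [dvd|]; last by rewrite ltnS => qn; rewrite dvdn_fact // prime_gt0.
  rewrite ltnS leqNgt; apply/negP => nq; move: dvd; apply/negP.
  elim: n nq => [|n IHn] nq; first by rewrite fact0 dvdn1 neq_ltn prime_gt1 ?orbT.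
  by rewrite factS Euclid_dvdM // negb_or IHn 1?ltnW // andbT gtnNdvd.
rewrite (@ln_prod _ _ (fun q => q ^ logn q n`!)%N) => [|q q_pr]; last first.
  by rewrite expn_gt0 prime_gt0.
by apply: eq_bigr => q q_pr; rewrite natrX lnXn ?ltr0n ?prime_gt0 // mulr_natl.
Qed.

Lemma logn_fact_ge q n : prime q -> (n %/ q <= logn q n`!)%N.
Proof.
move=> q_pr; rewrite logn_fact //; case: n => [|n]; first by rewrite div0n.
by rewrite big_ltn // expn1 leq_addr.
Qed.

Lemma logn_fact_le q n : prime q -> (q.-1 * logn q n`! <= n)%N.
Proof.
move=> q_pr; rewrite logn_fact //.
(* Multiplying [n %/ q ^ k] by q - 1 telescopes, because q times it is at most [n %/ q ^ k.-1]. *)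
suff H m : (q.-1 * \sum_(1 <= k < m.+1) n %/ q ^ k + n %/ q ^ m <= n)%N.
  by apply: leq_trans (H n); apply: leq_addr.
elim: m => [|m IHm]; first by rewrite big_geq // muln0 expn0 divn1.
rewrite big_nat_recr //= mulnDr -addnA; apply: leq_trans IHm; rewrite leq_add2l.
rewrite -mulSnr prednK ?prime_gt0 // expnSr divnMA mulnC.
exact: leq_trunc_div.
Qed.

Lemma ln_fact_ge n : n%:R * ln n%:R - n%:R <= ln n`!%:R :> R.
Proof.
elim: n => [|n IHn]; first by rewrite mul0r subr0 fact0 ln1.
rewrite factS natrM lnM ?posrE ?ltr0n ?fact_gt0 //.
case: n IHn => [|n] IHn; first by rewrite fact0 ln1 mulr0 addr0 add0r oppr_le0.
have step : n.+1%:R * (ln n.+2%:R - ln n.+1%:R) <= 1 :> R.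
  rewrite -ln_div ?posrE ?ltr0n //.
  have -> : n.+2%:R / n.+1%:R = 1 + n.+1%:R^-1 :> R.
    by rewrite -natr1 mulrDl divff ?pnatr_eq0 // mul1r.
  have H : ln (1 + n.+1%:R^-1) <= n.+1%:R^-1 :> R.
    by apply: le_ln1Dx; apply: lt_trans (_ : 0 < _); rewrite ?invr_gt0 ?ltr0n // oppr_lt0.
  apply: le_trans (ler_wpM2l (ler0n _ _) H) _.
  by rewrite divff ?pnatr_eq0.
have E : n.+2%:R = n.+1%:R + 1 :> R by rewrite natr1.
move: step IHn; rewrite E; set a : R := n.+1%:R; set x := ln (a + 1); set y := ln a.
set f := ln _; move=> step IHn; lra.
Qed.

Lemma ln_fact_le n : ln n`!%:R <= n%:R * ln n%:R :> R.
Proof.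
elim: n => [|n IHn]; first by rewrite mul0r fact0 ln1.
rewrite factS natrM lnM ?posrE ?ltr0n ?fact_gt0 //.
set x := ln n.+1%:R; rewrite -natr1 mulrDl mul1r addrC lerD2r {}/x.
apply: le_trans IHn _; apply: ler_wpM2l => //.
case: n => [|n]; first by rewrite ln0 // ln_nat_ge0.
by rewrite ler_ln ?posrE ?ltr0n // ler_nat.
Qed.

Definition mertens_sum n : R := \sum_(0 <= q < n.+1 | prime q) ln q%:R / q%:R.

(** Since n/q exceeds the exponent of q in n! by at most 1, the excess over ln n! is at most the sum
    of ln q, which [theta_le] bounds by 4n. *)
Lemma mertens_le n : (0 < n)%N -> mertens_sum n <= ln n%:R + 4.
Proof.
move=> n_gt0; have n0 : 0 < n%:R :> R by rewrite ltr0n.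
rewrite -(ler_pM2l n0) mulrDr.
have : n%:R * mertens_sum n - \sum_(0 <= q < n.+1 | prime q) ln q%:R <= ln n`!%:R.
  rewrite ln_fact /mertens_sum mulr_sumr -sumrB; apply: ler_sum => q q_pr.
  have q0 : 0 < q%:R :> R by rewrite ltr0n prime_gt0.
  rewrite mulrCA -[X in _ - X]mulr1 -mulrBr mulrC; apply: ler_wpM2r; first exact: ln_nat_ge0.
  apply: le_trans (_ : (n %/ q)%:R <= _); last by rewrite ler_nat logn_fact_ge.
  by rewrite lerBlDr natr1 ler_pdivrMr // -natrM ler_nat ltnW // ltn_ceil // prime_gt0.
by have := theta_le n; have := ln_fact_le n; lra.
Qed.

Lemma sum_ln_telescope n :
  \sum_(2 <= q < n.+1) ln q%:R / (q%:R * (q%:R - 1)) <= 2 :> R.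
Proof.
(* The remainder [(ln n + 2) / n] makes the bound inductive: its decrease covers the next term, and
   it equals 2 at n = 1. *)
suff : (0 < n)%N -> \sum_(2 <= q < n.+1) ln q%:R / (q%:R * (q%:R - 1)) <= 2 - (ln n%:R + 2) / n%:R :> R.
  case: n => [|n]; first by rewrite big_geq.
  move=> /(_ isT) /le_trans; apply; rewrite lerBlDr lerDl divr_ge0 //.
  by rewrite addr_ge0 ?ln_nat_ge0.
case: n => // n _; elim: n => [|n IHn]; first by rewrite big_geq // ln1 add0r divr1 subrr.
rewrite big_nat_recr //=; apply: le_trans (lerD IHn (lexx _)) _.
set a : R := n.+1%:R; have a1 : 1 <= a by rewrite ler1n.
have -> : n.+2%:R = a + 1 :> R by rewrite natr1.
have H : a * (ln (a + 1) - ln a) <= 1.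
  rewrite -ln_div ?posrE; [|lra|lra].
  have -> : (a + 1) / a = 1 + a^-1 by rewrite mulrDl divff ?mul1r //; lra.
  have H : ln (1 + a^-1) <= a^-1.
    by apply: le_ln1Dx; apply: lt_trans (_ : 0 < _); rewrite ?invr_gt0 ?oppr_lt0 //; lra.
  by apply: le_trans (ler_wpM2l _ H) _; rewrite ?divff //; lra.
rewrite -subr_ge0.
set x := ln (a + 1) in H *; set y := ln a in H *.
have -> : 2 - (x + 2) / (a + 1) - (2 - (y + 2) / a + x / ((a + 1) * (a + 1 - 1))) =
   (2 - (a + 1) * (x - y)) / (a * (a + 1)) by field; apply/andP; split; lra.
apply: divr_ge0; last nra.
have : x - y <= 1 by nra.
nra.
Qed.

(** The exponent of q in n! is at most n/(q - 1), and 1/(q - 1) = 1/q + 1/(q(q - 1)). The 3 is 1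
    from Stirling's bound [ln_fact_ge] and 2 from the convergent tail. *)
Lemma mertens_ge n : (0 < n)%N -> ln n%:R - 3 <= mertens_sum n.
Proof.
move=> n_gt0; have n0 : 0 < n%:R :> R by rewrite ltr0n.
have tail : \sum_(0 <= q < n.+1 | prime q) ln q%:R / (q%:R * (q%:R - 1)) <= 2 :> R.
  apply: le_trans (sum_ln_telescope n); rewrite big_mkcond big_ltn //= add0r big_ltn //= add0r.
  rewrite [leLHS]big_nat [leRHS]big_nat; apply: ler_sum => q /andP[q2 _]; case: ifP => // _.
  have q2R : 2 <= q%:R :> R by rewrite (ler_nat _ 2).
  apply: divr_ge0; first exact: ln_nat_ge0.
  by apply: mulr_ge0; lra.
have key : ln n`!%:R <= n%:R * (mertens_sum n +
    \sum_(0 <= q < n.+1 | prime q) ln q%:R / (q%:R * (q%:R - 1))) :> R.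
  rewrite ln_fact /mertens_sum -big_split /= mulr_sumr; apply: ler_sum => q q_pr.
  have q2R : 2 <= q%:R :> R by rewrite (ler_nat _ 2) prime_gt1.
  have -> : n%:R * (ln q%:R / q%:R + ln q%:R / (q%:R * (q%:R - 1))) =
     n%:R / (q%:R - 1) * ln q%:R :> R.
    by field; apply/andP; split; lra.
  apply: ler_wpM2r; first exact: ln_nat_ge0.
  have q1 : 0 < q%:R - 1 :> R by lra.
  have qE : q%:R - 1 = q.-1%:R :> R by rewrite -[in LHS](prednK (prime_gt0 q_pr)) -natr1 addrK.
  by rewrite ler_pdivlMr // qE -natrM ler_nat mulnC logn_fact_le.
have := ln_fact_ge n; set S := (\sum_(_ <= _ < _ | _) _) in tail key.
move=> low; rewrite -(ler_pM2l n0).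
have : n%:R * S <= n%:R * 2 by rewrite ler_pM2l.
lra.
Qed.

Lemma mertens_interval n m : (0 < n <= m)%N ->
  \sum_(n.+1 <= q < m.+1 | prime q) ln q%:R / q%:R = mertens_sum m - mertens_sum n.
Proof.
case/andP=> n_gt0 nm; rewrite /mertens_sum [X in _ = X - _](@big_cat_nat _ _ _ n.+1) //=.
by rewrite addrAC subrr add0r.
Qed.

(** On this block [ln q >= i * ln z], while Mertens' bounds give total weight at most ln z + 4 + 3.
    Blocks between powers of z turn the sum of 1/q into a harmonic sum over exponents, without
    partial summation. *)
Lemma prime_recip_block (z i : nat) : (1 < z)%N -> (0 < i)%N ->
  \sum_((z ^ i).+1 <= q < (z ^ i.+1).+1 | prime q) q%:R^-1 <=
  i%:R^-1 * (1 + 7 / ln z%:R) :> R.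
Proof.
move=> z_gt1 i_gt0; have z_gt0 := ltnW z_gt1.
have lnz : 0 < ln z%:R :> R by rewrite ln_gt0 // ltr1n.
have i0 : 0 < i%:R :> R by rewrite ltr0n.
have izE : ln (z ^ i)%:R = i%:R * ln z%:R :> R by rewrite natrX lnXn ?ltr0n // mulr_natl.
have iz1E : ln (z ^ i.+1)%:R = (i%:R + 1) * ln z%:R :> R.
  by rewrite natrX lnXn ?ltr0n // natr1 mulr_natl.
apply: (@le_trans _ _ ((\sum_((z ^ i).+1 <= q < (z ^ i.+1).+1 | prime q) ln q%:R / q%:R) / (i%:R * ln z%:R))).
  rewrite mulr_suml big_nat_cond [leRHS]big_nat_cond; apply: ler_sum => q /andP[/andP[zq _] q_pr].
  have q0 : 0 < q%:R :> R by rewrite ltr0n prime_gt0.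
  rewrite ler_pdivlMr ?mulr_gt0 // mulrC; apply: ler_wpM2r; first by rewrite invr_ge0 ltW.
  by rewrite -izE ler_ln ?posrE ?ltr0n ?expn_gt0 ?z_gt0 ?prime_gt0 // ler_nat ltnW.
rewrite mertens_interval; last by rewrite expn_gt0 z_gt0 leq_exp2l // ltnW.
have := mertens_le (_ : 0 < z ^ i.+1)%N; rewrite expn_gt0 z_gt0 => /(_ isT) le.
have := mertens_ge (_ : 0 < z ^ i)%N; rewrite expn_gt0 z_gt0 => /(_ isT) ge.
rewrite izE in ge; rewrite iz1E in le.
rewrite ler_pdivrMr ?mulr_gt0 //.
have -> : i%:R^-1 * (1 + 7 / ln z%:R) * (i%:R * ln z%:R) = ln z%:R + 7 :> R.
  by field; apply/andP; split; apply: lt0r_neq0.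
lra.
Qed.

Lemma prime_recip_sum (z u n : nat) : (1 < z)%N -> (0 < u <= n)%N ->
  \sum_((z ^ u).+1 <= q < (z ^ n).+1 | prime q) q%:R^-1 <=
  (\sum_(u <= i < n) i%:R^-1) * (1 + 7 / ln z%:R) :> R.
Proof.
move=> z_gt1 /andP[u_gt0]; elim: n => [|n IHn] un; first by case: u u_gt0 un.
move: un; rewrite leq_eqVlt => /orP[/eqP->|]; first by rewrite !big_geq // mul0r.
rewrite ltnS => un.
rewrite (@big_cat_nat _ _ _ (z ^ n).+1) /= ?ltnS ?leq_exp2l //.
rewrite [in leRHS]big_nat_recr //= mulrDl lerD ?IHn //.
by apply: prime_recip_block => //; apply: leq_trans un.
Qed.

Lemma prime_count_ge : exists C : nat, (0 < C)%N /\ forall z : nat, (C <= z)%N ->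
  z%:R <= C%:R * #|[pred s : 'I_z.+1 | prime s]|%:R * ln z%:R :> R.
Proof.
(* As 8 = 1 + 3 + 4, Mertens' bounds leave weight at least 1 on the primes in (z/K, z], each of
   which weighs at most K ln z / z. *)
pose K := Num.bound (expR 8 : R).
have K8 : expR 8 < K%:R :> R by apply: archi_boundP; apply: expR_ge0.
have K0 : 0 < K%:R :> R by apply: lt_trans K8; apply: expR_gt0.
have lnK : 8 <= ln K%:R :> R by rewrite -[8](@expRK R) ler_ln ?posrE ?expR_gt0 // ltW.
exists K; split=> [|z Kz]; first by rewrite -(ltr0n R).
have K_gt0 : (0 < K)%N by rewrite -(ltr0n R).
have z_gt0 := leq_trans K_gt0 Kz; have z0 : 0 < z%:R :> R by rewrite ltr0n.
set x := (z %/ K)%N; have x_gt0 : (0 < x)%N by rewrite divn_gt0.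
have xz : (x <= z)%N by apply: leq_div.
have lnx : ln x%:R <= ln z%:R - ln K%:R :> R.
  rewrite -ln_div ?posrE // ler_ln ?posrE ?ltr0n ?divr_gt0 //.
  by rewrite ler_pdivlMr // -natrM ler_nat leq_trunc_div.
have low : 1 <= \sum_(x.+1 <= q < z.+1 | prime q) ln q%:R / q%:R :> R.
  rewrite mertens_interval ?x_gt0 //.
  by have := mertens_ge z_gt0; have := mertens_le x_gt0; lra.
pose c : R := ln z%:R * (K%:R / z%:R).
have c0 : 0 <= c by rewrite mulr_ge0 ?ln_nat_ge0 // divr_ge0 ?ler0n.
have up : \sum_(x.+1 <= q < z.+1 | prime q) ln q%:R / q%:R <=
    #|[pred s : 'I_z.+1 | prime s]|%:R * c.
  rewrite mulr_natl -sumr_const.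
  apply: (@le_trans _ _ (\sum_(0 <= q < z.+1 | prime q) c)); last by rewrite big_mkord.
  rewrite [leRHS](@big_cat_nat _ _ _ x.+1) //= -[leLHS]add0r lerD ?sumr_ge0 //.
  rewrite big_nat_cond [leRHS]big_nat_cond; apply: ler_sum => q /andP[/andP[xq qz] q_pr].
  have q0 : 0 < q%:R :> R by rewrite ltr0n prime_gt0.
  apply: ler_pM; rewrite ?ln_nat_ge0 ?invr_ge0 ?ler0n //.
    by rewrite ler_ln ?posrE // ler_nat -ltnS.
  rewrite ler_pdivlMr // mulrC ler_pdivrMr // -natrM ler_nat ltnW // mulnC.
  by apply: leq_trans (ltn_ceil z K_gt0) _; rewrite leq_mul2r xq orbT.
have := le_trans low up; rewrite /c; set P := #|_|%:R => H.
by rewrite -[leLHS]mul1r -ler_pdivlMr //; apply: le_trans H _; rewrite le_eqVlt;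
   apply/orP; left; apply/eqP; ring.
Qed.

End Mertens.

(** * Choice of parameters *)

Lemma floor_root (k z : nat) : (0 < k)%N -> exists d : nat, (d ^ k <= z < d.+1 ^ k)%N.
Proof.
move=> k_gt0; elim: z => [|z [d /andP[le lt]]]; first by exists 0%N; rewrite exp0n // exp1n.
case: (ltnP z.+1 (d.+1 ^ k)) => H; first by exists d; rewrite H leqW.
exists d.+1; rewrite H /= -ltnS; apply: leq_ltn_trans lt _.
by rewrite ltn_exp2r.
Qed.

Lemma card_multiples (N q : nat) : (0 < q)%N ->
  (#|[pred k : 'I_N | (q %| k.+1)%N]| <= N %/ q)%N.
Proof.
move=> q_gt0; rewrite -[leqRHS](size_iota 0) cardE.
rewrite -(size_map (fun k : 'I_N => (k.+1 %/ q).-1)); apply: uniq_leq_size.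
  rewrite map_inj_in_uniq ?enum_uniq // => k k'; rewrite !mem_enum !inE.
  move=> /dvdnP[a ka] /dvdnP[a' ka']; rewrite ka ka' !mulnK // => E.
  by apply/val_inj/succn_inj; rewrite ka ka'; congr (_ * _)%N; case: a a' E ka ka' => [|a] [|a'] //= ->.
move=> d /mapP[k]; rewrite mem_enum inE mem_iota /= add0n => dvd ->.
have k_gt0 : (0 < k.+1 %/ q)%N by rewrite divn_gt0 // dvdn_leq.
by rewrite prednK // leq_div2r.
Qed.

Definition smooth (U m : nat) : bool := all (fun q => q <= U)%N (primes m).

Section SubpolynomialParameter.

Variable R : realType.

(* D plays the role of p^o(1): it bounds divisor functions, yet any fixed power of it
   stays below z. *)
Lemma subpoly_param (M k : nat) : exists z0 : nat, forall z : nat, (z0 <= z)%N ->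
  exists D : nat, [/\ (D ^ M <= z)%N, (M <= D)%N,
    forall x : nat, (0 < x <= z ^ k)%N -> (size (divisors x) <= D)%N &
    (z <= D * #|[pred s : 'I_z.+1 | prime s]|)%N].
Proof.
have [C0 [C0_gt0 piC]] := prime_count_ge R.
(* With d the integer part of the M1-th root of z, [D = d ^ 3] satisfies [D ^ M <= z]. One factor d
   bounds divisor functions; all three absorb C0, M1 and ln z <= M1 d in the prime count. *)
pose M1 := (3 * M).+1.
(* A number up to z^k with more than d divisors would give z^(2(k+1)) < C1 z^k, against C1 <= z. *)
have [C1 tauC] := divisor_bound (2 * M1 * k.+1).
pose m := (M + C0 + M1 + 1)%N.
exists (m ^ M1 + C0 + C1 + 2)%N => z z_ge.
have [d /andP[dz zd]] := @floor_root M1 z isT.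
have md : (m <= d)%N.
  rewrite -ltnS -(@ltn_exp2r _ _ M1) //; apply: leq_ltn_trans zd; lia.
have d_gt0 : (0 < d)%N by apply: leq_trans md; rewrite /m addn1.
have d3 : (d <= d ^ 3)%N by rewrite -{1}(expn1 d) leq_pexp2l.
have z_gt1 : (1 < z)%N by lia.
exists (d ^ 3)%N; split.
- by rewrite -expnM; apply: leq_trans dz; rewrite leq_pexp2l.
- by apply: leq_trans d3; apply: leq_trans md; rewrite /m; lia.
- move=> x /andP[x_gt0 xz]; apply: leq_trans d3; rewrite leqNgt; apply/negP => lt_d.
  have : (d.+1 ^ (2 * M1 * k.+1) <= C1 * z ^ k)%N.
    apply: leq_trans (leq_trans (tauC x x_gt0) _); first exact: leq_exp2r_w.
    by rewrite leq_mul2l xz orbT.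
  apply/negP; rewrite -ltnNge.
  have -> : (2 * M1 * k.+1 = M1 * (k.+1 + k.+1))%N by lia.
  rewrite expnM; apply: (@leq_ltn_trans (z * z ^ k)).
    by rewrite leq_mul2r; apply/orP; right; lia.
  rewrite -expnS; apply: (@leq_ltn_trans (z ^ (k.+1 + k.+1))).
    by rewrite leq_pexp2l //; lia.
  by rewrite ltn_exp2r.
rewrite -(ler_nat R); apply: le_trans (piC z _) _; first by lia.
have d1 : 1 <= d%:R :> R by rewrite ler1n.
have lnz : ln z%:R <= (M1 * d)%:R :> R.
  apply: (@le_trans _ _ (ln (d.+1 ^ M1)%:R)).
    by rewrite ler_ln ?posrE ?ltr0n ?expn_gt0 ?(ltnW z_gt1) // ler_nat ltnW.
  rewrite natrX lnXn // natrM -[leLHS]mulr_natl; apply: ler_wpM2l => //.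
  by rewrite -natr1 addrC le_ln1Dx //; lra.
rewrite natrM [X in X * _ <= _]mulrC -mulrA mulrC; apply: ler_wpM2r => //.
apply: le_trans (ler_wpM2l (ler0n _ C0) lnz) _; rewrite -natrM ler_nat.
have C0d : (C0 <= d)%N by apply: leq_trans md; rewrite /m; lia.
have M1d : (M1 <= d)%N by apply: leq_trans md; rewrite /m; lia.
by rewrite !expnS expn0 muln1; apply: leq_mul => //; apply: leq_mul.
Qed.

Lemma card_rough (N U : nat) :
  (#|[pred k : 'I_N | ~~ smooth U k.+1]|%:R : R) <=
  N%:R * \sum_(U.+1 <= q < N.+1 | prime q) q%:R^-1.
Proof.
apply: (@le_trans _ _ (\sum_(U.+1 <= q < N.+1 | prime q) (N %/ q))%N%:R); last first.
  rewrite natr_sum mulr_sumr; apply: ler_sum => q q_pr.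
  by rewrite ler_pdivlMr ?ltr0n ?prime_gt0 // -natrM ler_nat leq_trunc_div.
rewrite ler_nat -sum1_card.
apply: (@leq_trans (\sum_(U.+1 <= q < N.+1 | prime q) \sum_(k < N | q %| k.+1) 1)%N); last first.
  by apply: leq_sum => q q_pr; rewrite sum1_card card_multiples // prime_gt0.
rewrite (exchange_big_dep xpredT) //= big_mkcond; apply: leq_sum => k _.
case: ifP => // /allPn[q]; rewrite mem_primes -ltnNge => /and3P[q_pr _ dvd] Uq.
rewrite -big_filter (bigD1_seq q) ?filter_uniq ?iota_uniq //=.
by rewrite mem_filter dvd q_pr mem_index_iota Uq ltnS (leq_trans (dvdn_leq _ dvd)).
Qed.

(** The gap g = 1/2 - s is strict, so once 7s / ln z <= g/2 the factor 1 + 7 / ln z uses up only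
    half of it. Any c0 > 1/g then records the surplus of smooth over rough integers as an inequality
    in naturals. *)
Lemma rough_density (u n : nat) : (0 < u <= n)%N ->
  \sum_(u <= i < n) i%:R^-1 < 2^-1 :> R ->
  exists c0 z0 : nat, forall z : nat, (z0 <= z)%N ->
  (z ^ n + 2 * c0 * #|[pred k : 'I_(z ^ n) | ~~ smooth (z ^ u) k.+1]| <= c0 * z ^ n)%N.
Proof.
move=> un; set s := \sum_(_ <= _ < _) _ => s_lt.
have s0 : 0 <= s by apply: sumr_ge0 => i _; rewrite invr_ge0.
pose g : R := 2^-1 - s; have g0 : 0 < g by rewrite /g; lra.
pose c0 := Num.bound g^-1.
have c0_gt : g^-1 < c0%:R by apply: archi_boundP; rewrite invr_ge0 ltW.
pose z0 := Num.bound (expR (14 * s / g)).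
have z0_gt : expR (14 * s / g) < z0%:R by apply: archi_boundP; apply: expR_ge0.
exists c0, (z0 + 2)%N => z z_ge.
have z_gt1 : (1 < z)%N by lia.
have lnz : 14 * s / g <= ln z%:R.
  rewrite -[leLHS](@expRK R) ler_ln ?posrE ?expR_gt0 ?ltr0n 1?ltnW //.
  by apply/ltW/(lt_le_trans z0_gt); rewrite ler_nat; lia.
have lnz0 : 0 < ln z%:R :> R by rewrite ln_gt0 // ltr1n.
have := card_rough (z ^ n) (z ^ u); set rough := #|_|%:R.
have := prime_recip_sum R z_gt1 un; rewrite -/s; set S := \sum_(_ <= _ < _ | _) _ => Sle rle.
have S_le : S <= 2^-1 - g / 2.
  apply: le_trans Sle _.
  have : 7 * s / ln z%:R <= g / 2.
    by rewrite ler_pdivrMr // -ler_pdivrMl ?divr_gt0 // (le_trans _ lnz) // le_eqVlt;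
       apply/orP; left; apply/eqP; field; apply: lt0r_neq0.
  by rewrite mulrDr mulr1 mulrA [s * 7]mulrC /g; lra.
have N0 : 0 < (z ^ n)%:R :> R by rewrite ltr0n expn_gt0 ltnW.
rewrite -(ler_nat R) natrD !natrM -/rough.
have r1 : rough <= (z ^ n)%:R * (2^-1 - g / 2).
  by apply: le_trans rle _; rewrite ler_pM2l.
have c00 : 0 <= c0%:R :> R by [].
have cg : 1 <= c0%:R * g by rewrite -ler_pdivrMr // mul1r ltW.
have : c0%:R * rough <= c0%:R * ((z ^ n)%:R * (2^-1 - g / 2)) by rewrite ler_wpM2l.
have : (z ^ n)%:R * 1 <= (z ^ n)%:R * (c0%:R * g) by rewrite ler_pM2l.
set N : R := (z ^ n)%:R; lra.
Qed.

Lemma sum_inv_le_ln (u n : nat) : (0 < u <= n)%N ->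
  \sum_(u.+1 <= i < n.+1) i%:R^-1 <= ln n%:R - ln u%:R :> R.
Proof.
move=> /andP[u_gt0]; elim: n => [|n IHn] un; first by case: u u_gt0 un.
move: un; rewrite leq_eqVlt => /orP[/eqP<-|]; first by rewrite big_geq // subrr.
rewrite ltnS => un; rewrite big_nat_recr //=.
have n_gt0 : (0 < n)%N := leq_trans u_gt0 un.
have n1 : 1 <= n%:R :> R by rewrite ler1n.
have inv_lt1 : n.+1%:R^-1 < 1 :> R by rewrite invf_lt1 ?ltr0n // ltr1n.
have : ln (1 + - n.+1%:R^-1) <= - n.+1%:R^-1 :> R by apply: le_ln1Dx; rewrite ltrN2.
have -> : 1 + - n.+1%:R^-1 = n%:R / n.+1%:R :> R.
  by rewrite -natr1; field; lra.
rewrite ln_div ?posrE ?ltr0n //; have := IHn un.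
by move: (n.+1%:R^-1) (ln n.+1%:R) (ln n%:R) (\sum_(_ <= _ < _) _) => v w x S; lra.
Qed.

(** The conditions on u serve, in order: z^u <= U, room in nine factors, [N <= U ^ 2] for
    [smooth_prod3], and rough density below one half. *)
Lemma exponent_choice (eps : R) : 0 < eps -> exists l u : nat,
  [/\ (0 < l)%N, u%:R <= (2^-1 * expR (- 2^-1) + eps) * (6 * l)%:R,
      (2 * (3 * l + 2) + 10 * l <= 9 * u.-1)%N,
      (0 < u <= 3 * l + 2)%N /\ (3 * l + 2 <= 2 * u)%N &
      \sum_(u <= i < 3 * l + 2) i%:R^-1 < 2^-1 :> R].
Proof.
move=> eps0; pose e : R := expR (- 2^-1).
have e_up : e <= 2 / 3.
  rewrite /e expRN invf_ple ?posrE ?expR_gt0 //; last lra.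
  by apply: le_trans (expR_ge1Dx _); lra.
(* The nine factors need 27e > 16; (1 - 1/32)^16 is already above 3/5. *)
have e_lo : 3 / 5 <= e.
  have -> : e = expR (- 32^-1) ^+ 16 by rewrite /e -expRM_natl; congr expR; lra.
  apply: (@le_trans _ _ ((31 / 32) ^+ 16)); first lra.
  by rewrite lerXn2r ?nnegrE ?expR_ge0 //; [lra | apply: le_trans (expR_ge1Dx _); lra].
have e_inv : e * expR 2^-1 = 1 by rewrite /e -expRD addNr expR0.
pose l := (Num.bound eps^-1).+1.
have l_gt : eps^-1 < l%:R.
  by rewrite -natr1 ltr_wpDr // archi_boundP // invr_ge0 ltW.
have l1 : 1 <= l%:R :> R by rewrite ler1n.
have x0 : 0 <= 2^-1 * e * (6 * l)%:R by rewrite mulr_ge0 ?ler0n // mulr_ge0 ?invr_ge0 ?expR_ge0.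
have /andP[t_lo t_up] := truncn_itv x0; set t := Num.truncn _ in t_lo t_up.
(* t is the integer part of 3l e^(-1/2). The added 3 pays for the excess 2 of 3l + 2 and the index
   shift in [sum_inv_le_ln], and costs less than 6l eps. *)
exists l, (t + 3)%N; rewrite natrM in t_lo t_up *.
have epsl : 1 < eps * l%:R by rewrite mulrC -ltr_pdivrMr // mul1r.
rewrite -(natr1 t) in t_up.
have tl_up : t%:R <= 2 * l%:R :> R by nra.
have tl_lo : 9 / 5 * l%:R < t%:R + 1 :> R by nra.
split.
- by [].
- by rewrite natrD -/e; lra.
- clearbody t l e; have : (16 * l + 4 <= 9 * t + 18)%N by rewrite -(ler_nat R); lra.
  by clear; move=> H; lia.
- clearbody t l e; split.
    have : (t + 1 <= 3 * l)%N by rewrite -(ler_nat R); lra.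
    by clear; move=> H; lia.
  have : (3 * l <= 2 * t + 4)%N by rewrite -(ler_nat R); lra.
  by clear; move=> H; lia.
clearbody t l e; have -> : (t + 3 = t.+2.+1)%N by rewrite addnC.
have -> : (3 * l + 2 = (3 * l).+1.+1)%N by rewrite addnC.
have un : (0 < t.+2 <= (3 * l).+1)%N.
  have : (t + 1 <= 3 * l)%N by rewrite -(ler_nat R); lra.
  by clear; move=> H; lia.
apply: le_lt_trans (sum_inv_le_ln un) _.
rewrite -ln_div ?posrE ?ltr0n // -[ltRHS](@expRK R) ltr_ln ?posrE ?expR_gt0 ?divr_gt0 ?ltr0n //.
rewrite ltr_pdivrMr ?ltr0n // -(natr1 t.+1) -(natr1 t) -(natr1 (3 * l)) natrM.
have E1 : 1 <= expR (2^-1 : R) by apply: le_trans (expR_ge1Dx _); lra.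
set E := expR 2^-1 in e_inv E1 *.
have : 3 * l%:R < E * (t%:R + 1).
  have -> : 3 * l%:R = E * (2^-1 * e * (6 * l%:R)).
    have -> : E * (2^-1 * e * (6 * l%:R)) = e * E * (3 * l%:R) by field.
    by rewrite e_inv mul1r.
  by rewrite ltr_pM2l //; lra.
nra.
Qed.

End SubpolynomialParameter.

(** * Nine summands *)

(** The cube of the sum runs over products of three integers; a pair of products has at most D^3
    times D^3 factorisations, so the moment reduces to [card_fq_pairs] at length N^3. *)
Lemma sixth_moment (p N D Y : nat) (p_pr : prime p) (w : 'I_N -> algC) :
  (N < p)%N -> (0 < Y)%N -> (forall x, (0 < x <= N ^ 3)%N -> (size (divisors x) <= D)%N) ->
  (forall k, `|w k| <= 1) ->
  \sum_c `|\sum_k w k * ec p_pr (c * fq p k.+1)| ^+ 6 <=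
  (p * (D ^ 6 * (4 * p * ((N ^ 3) ^ 2 %/ p ^ 2) + 4 * p * (N ^ 3 %/ Y) + 8 * N ^ 3 * Y)))%:R.
Proof.
move=> Np Y_gt0 tauD w1; pose F (v : {ffun 'I_3 -> 'I_N}) := \sum_i fq p (v i).+1.
have cube c : `|\sum_k w k * ec p_pr (c * fq p k.+1)| ^+ 6 =
    `|\sum_(v : {ffun 'I_3 -> 'I_N}) (\prod_i w (v i)) * ec p_pr (c * F v)| ^+ 2.
  by rewrite -(sum_ec_pow p_pr w (fun k : 'I_N => fq p k.+1) 3) normrX -exprM.
under eq_bigr do rewrite cube.
apply: le_trans (moment2_le p_pr F _) _.
  by move=> v; rewrite normr_prod; apply: prodr_ile1 => i _; rewrite normr_ge0 w1.
rewrite ler_nat leq_mul2l; apply/orP; right.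
set Q := [set _ | _].
pose prodv (v : {ffun 'I_3 -> 'I_N}) := (\prod_i (v i).+1)%N.
have prodv_gt0 v : (0 < prodv v)%N by apply: prodn_gt0.
have prodv_le v : (prodv v <= N ^ 3)%N.
  by rewrite -[in leqRHS](card_ord 3) -prod_nat_const; apply: leq_prod => i _; apply: ltn_ord.
have cop_small (k : 'I_N) : coprime k.+1 p.
  by apply: small_coprime => //=; apply: leq_ltn_trans Np.
have cop_prodv v : coprime (prodv v) p by apply: coprime_prodn.
have fq_prodv v : fq p (prodv v) = F v.
  rewrite /prodv -(big_map (fun i => (v i).+1) xpredT id) fq_prod //.
    by rewrite big_map.
  by apply/allP => _ /mapP[i _ ->].
have idx v : ((prodv v).-1 < N ^ 3)%N by rewrite prednK.
pose phi (vv : {ffun 'I_3 -> 'I_N} * {ffun 'I_3 -> 'I_N}) :=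
  (Ordinal (idx vv.1), Ordinal (idx vv.2)).
apply: leq_trans (_ : D ^ 6 * #|fq_pairs p (N ^ 3)| <= _)%N; last first.
  by rewrite leq_mul2l card_fq_pairs ?orbT.
rewrite -sum1_card (partition_big phi [in fq_pairs p (N ^ 3)]) /=; last first.
  move=> [v v']; rewrite inE /= => /eqP E.
  by rewrite inE /= !prednK // !cop_prodv !fq_prodv E eqxx.
rewrite mulnC -sum_nat_const; apply: leq_sum => xy _; rewrite sum1dep_card.
pose DV (x : nat) := [set v : {ffun 'I_3 -> 'I_N} | [forall i, ((v i).+1 %| x)%N]].
apply: leq_trans (_ : #|setX (DV xy.1.+1) (DV xy.2.+1)| <= _)%N.
  apply/subset_leq_card/subsetP => -[v v']; rewrite inE => /andP[_ /eqP <-].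
  have dvd_prodv (x : {ffun 'I_3 -> 'I_N}) i : ((x i).+1 %| prodv x)%N.
    by rewrite /prodv (bigD1 i) //= dvdn_mulr.
  by rewrite !inE /= !prednK //; apply/andP; split; apply/forallP => i; apply: dvd_prodv.
rewrite cardsX (expnD D 3 3).
have inj : injective (fun k : 'I_N => k.+1) by move=> a b /succn_inj/val_inj.
have DV_le x : (0 < x <= N ^ 3)%N -> (#|DV x| <= D ^ 3)%N.
  by move=> /[dup] /andP[x0 _] xN; apply: (@card_ffun_divisors _ _ 3 _ _ inj x0 (tauD _ xN)).
by apply: leq_mul; apply: DV_le; rewrite ltn_ord.
Qed.

Lemma ec_count (p : nat) (p_pr : prime p) (I : finType) (w : I -> algC) (F : I -> 'F_p) (x : 'F_p) :
  \sum_c ec p_pr (- (c * x)) * \sum_t w t * ec p_pr (c * F t) =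
  p%:R * \sum_(t | F t == x) w t.
Proof.
under eq_bigr do rewrite mulr_sumr.
rewrite exchange_big mulr_sumr [RHS]big_mkcond; apply: eq_bigr => t _ /=.
transitivity (w t * \sum_c ec p_pr (c * (F t - x))).
  rewrite mulr_sumr; apply: eq_bigr => c _.
  by rewrite mulrCA -ecD mulrBr addrC.
by rewrite sum_ec subr_eq0; case: ifP => _; rewrite ?mulr0 // mulrC.
Qed.

(* z is the integer part of the 6l-th root of p, so that p^(1/2) is about z ^ (3 l); N = z ^ n is slightly
   longer, U = z ^ u, and the m tiny primes have product about z ^ m = p^(5/3). *)
Section Core.

Variables (p l u z D c0 : nat).
Let L := (6 * l)%N.
Let n := (3 * l + 2)%N.
Let m := (10 * l)%N.
(** Burgess' bound is used with B = z and needs [p <= z ^ r]; since [z ^ L < p], one more factor z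
    is required. *)
Let r := L.+1.
Let N := (z ^ n)%N.
Let T : finType := {s : 'I_z.+1 | prime s}.
Let C1 := (r ^ (2 * r) + 2 * r)%N.
Let C2 := (16 * 4 ^ L)%N.
Let C3 := (c0 ^ 6 * C2 * 2 ^ (10 * L))%N.
(** [6 * m + 16 + 10 * L] is the power of D collected in [main_count_le]; the remaining summands
    make D exceed each constant. *)
Let M := (2 * r * (6 * m + 16 + 10 * L) + 10 * r + 2 + C1 + C3 + 2 ^ L + (2 * L ^ 2) ^ L + 32)%N.

Hypotheses (p_pr : prime p) (l_gt0 : (0 < l)%N).
Hypotheses (zp : (z ^ L < p)%N) (pz : (p <= z.+1 ^ L)%N).
Hypotheses (u_cap : (2 * n + m <= 9 * u.-1)%N) (u_gt0 : (0 < u)%N) (un : (u <= n)%N) (nu : (n <= 2 * u)%N).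
Hypotheses (Dz : (D ^ M <= z)%N) (MD : (M <= D)%N).
Hypothesis tauD : forall x : nat, (0 < x <= z ^ (15 * l))%N -> (size (divisors x) <= D)%N.
Hypothesis primesD : (z <= D * #|[pred s : 'I_z.+1 | prime s]|)%N.
Hypothesis roughN : (N + 2 * c0 * #|[pred k : 'I_N | ~~ smooth (z ^ u) k.+1]| <= c0 * N)%N.

Let D_gt1 : (1 < D)%N. Proof. by apply: leq_trans MD; rewrite /M; clear; lia. Qed.

Let D_exp (e : nat) : (e <= M)%N -> (D ^ e <= z)%N.
Proof. by move=> eM; apply: leq_trans Dz; rewrite leq_pexp2l // ltnW. Qed.

Let z_gt1 : (1 < z)%N.
Proof. by apply: leq_trans D_gt1 _; rewrite -{1}(expn1 D) D_exp // /M; clear; lia. Qed.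

Let z_gt0 : (0 < z)%N := ltnW z_gt1.

Let p_le : (p <= 2 ^ L * z ^ L)%N.
Proof. by apply: leq_trans pz _; rewrite -expnMn leq_exp2r_w //; move: z_gt1; clear; lia. Qed.

Let zexp_le (i j : nat) : (i <= j)%N -> (z ^ i <= z ^ j)%N.
Proof. by move=> ij; rewrite leq_pexp2l. Qed.

Let zexp_lt_p (i : nat) : (i <= L)%N -> (z ^ i < p)%N.
Proof. by move=> iL; apply: leq_ltn_trans zp; apply: zexp_le. Qed.

Let N_lt_p : (N < p)%N.
Proof. by apply: zexp_lt_p; rewrite /n /L; move: l_gt0; clear; lia. Qed.

Let N_gt0 : (0 < N)%N. Proof. by rewrite expn_gt0 z_gt0. Qed.

Let S (c : 'F_p) := \sum_(t : T) ec p_pr (c * fq p (val (val t))).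
Let E (c : 'F_p) := \sum_(k < N) ec p_pr (c * fq p k.+1).
Let sg (k : 'I_N) : algC := if smooth (z ^ u) k.+1 then 1 else -1.
Let Y (c : 'F_p) := \sum_k sg k * ec p_pr (c * fq p k.+1).

(** The 2 in n = 3l + 2: N = A B z with A = z^(3l) and B = z, the last z being the saving. Likewise
    NA = z^L z z, where one z is the saving and the other absorbs [D * C1 * 2 ^ L]. *)
Let E_bound (c : 'F_p) : c != 0 -> `|E c| ^+ (2 * r) * z%:R <= (32 ^ r * N ^ (2 * r))%:R.
Proof.
move=> cn0.
have -> : E c = \sum_(k < N) chi p_pr c k.+1.
  apply: eq_bigr => k _; rewrite /chi ifT //; apply: small_coprime => //=.
  by apply: leq_ltn_trans N_lt_p.
have AB : (z ^ (3 * l) * z * z = N)%N by rewrite -!expnSr /N /n; congr (_ ^ _)%N; clear; lia.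
have NAE : (N * z ^ (3 * l) = z ^ (L + 2))%N.
  by rewrite -expnD /n /L; congr (_ ^ _)%N; clear; lia.
have DC : (D * C1 * 2 ^ L <= z)%N.
  apply: leq_trans (D_exp (_ : 3 <= M)%N); last by rewrite /M; clear; lia.
  by rewrite !expnS expn0 muln1 mulnA leq_mul // ?leq_mul //; apply: leq_trans MD; rewrite /M; clear; lia.
apply: (@burgess_bound p N (z ^ (3 * l)) z r D) => //.
- apply: leq_ltn_trans (_ : z ^ n.+1 < _)%N; last first.
    by apply: zexp_lt_p; rewrite /n /L; move: l_gt0; clear; lia.
  have := leq_mul (leqnn N) z_gt1; rewrite -/N expnSr.
  have : (z ^ (3 * l) * z <= N)%N by rewrite -AB leq_pmulr.
  by clear; rewrite -/N; lia.
- rewrite NAE -mulnn; apply: leq_ltn_trans (_ : z ^ L * z ^ L < _)%N.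
    by rewrite -expnD zexp_le // /L; move: l_gt0; clear; lia.
  by rewrite ltn_mul.
- by rewrite expn_gt0 z_gt0.
- by apply: ltnW; rewrite -(expn1 z) zexp_lt_p // /L; move: l_gt0; clear; lia.
- move=> x /andP[x_gt0 xle]; apply: tauD; rewrite x_gt0 (leq_trans xle) // NAE zexp_le //.
  by rewrite /L; move: l_gt0; clear; lia.
- rewrite /r expnSr; apply: leq_trans p_le _; rewrite mulnC leq_mul //.
  by apply: leq_trans DC; rewrite leq_pmull // muln_gt0 (ltnW D_gt1) addn_gt0 expn_gt0.
- rewrite NAE -/C1 expnD; apply: (@leq_trans (z * (D * C1 * (2 ^ L * z ^ L)))).
    by rewrite !leq_mul.
  have -> : (z * (D * C1 * (2 ^ L * z ^ L)) = z ^ L * ((D * C1 * 2 ^ L) * z))%N by ring.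
  by rewrite leq_mul2l -mulnn leq_mul // orbT.
- by rewrite AB.
Qed.

Let card_T_le : (#|T| <= z)%N.
Proof.
rewrite card_sig; apply: leq_trans (_ : #|[pred s : 'I_z.+1 | s != ord0]| <= _)%N.
  by apply/subset_leq_card/subsetP => s; rewrite !inE; apply: contraTneq => ->.
by rewrite (cardC1 ord0) card_ord.
Qed.

(** Since z^L is just below p, the main and the diagonal term of [psum_moment_le] both fit under p^2
    times a power of D. *)
Let S_moment : \sum_c `|S c| ^+ (2 * L) <= (p ^ 2 * D ^ (2 * L + 2))%:R.
Proof.
have inj : injective (fun t : T => val (val t) : nat) by move=> s t /val_inj/val_inj.
have v_pr (t : T) : prime (val (val t)) by apply: (valP t).
have v_le (t : T) : (val (val t) <= z)%N by rewrite -ltnS ltn_ord.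
have tauL x : (0 < x <= z ^ L)%N -> (size (divisors x) <= D)%N.
  by move=> /andP[x0 xz]; apply: tauD; rewrite x0 (leq_trans xz) // zexp_le // /L; clear; lia.
have L_gt0 : (0 < L)%N by rewrite /L; move: l_gt0; clear; lia.
apply: le_trans (psum_moment_le p_pr inj v_pr v_le zp tauL L_gt0) _.
rewrite ler_nat expnMn.
have lo : (#|T| ^ L <= p)%N by apply: leq_trans (ltnW zp); apply: leq_exp2r_w.
have KD : ((2 * L ^ 2) ^ L <= D)%N by apply: leq_trans MD; rewrite /M; clear; lia.
have D3 : (2 < D)%N by apply: leq_trans MD; rewrite /M; clear; lia.
have DL : (D <= D ^ (2 * L))%N.
  by rewrite -{1}(expn1 D) leq_pexp2l ?(ltnW D_gt1) // /L; move: l_gt0; clear; lia.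
rewrite expnD; move: lo KD D3 DL.
move: (#|T| ^ L)%N ((2 * L ^ 2) ^ L)%N (D ^ (2 * L))%N => a b d.
clear; rewrite -!mulnn => ap bD D3 Dd.
have : (p * (b * a) <= p * (D * p))%N by rewrite leq_mul // leq_mul.
have : (p * (D * p) <= p * (d * p))%N by rewrite leq_mul // leq_mul.
have : (3 * (p * (d * p)) <= D * D * (p * (d * p)))%N by apply: leq_mul => //; nia.
lia.
Qed.

(** With X = N^3, the height cutoff z^(3l), about p^(1/2), balances p^2 X / cutoff against p X
    cutoff. Both are about p^(3/2) X, hence of order at most X^2. *)
Let Y_moment : \sum_c `|Y c| ^+ 6 <= (D ^ 6 * C2 * N ^ 6)%:R.
Proof.
have NX : (N ^ 3 = z ^ (9 * l + 6))%N by rewrite -expnM /n; congr (_ ^ _)%N; clear; lia.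
apply: le_trans (@sixth_moment p N D (z ^ (3 * l)) p_pr sg N_lt_p _ _ _) _.
- by rewrite expn_gt0 z_gt0.
(* The longest range in which divisors are bounded: 9l + 6 <= 15l because l >= 1. *)
- move=> x /andP[x0 xN]; apply: tauD; rewrite x0 (leq_trans xN) // NX zexp_le //.
  by move: l_gt0; clear; lia.
- by move=> k; rewrite /sg; case: ifP => _; rewrite ?normrN normr1.
rewrite ler_nat.
set X := (N ^ 3)%N in NX *; have N6 : (N ^ 6 = X ^ 2)%N by rewrite /X -expnM.
rewrite N6 mulnCA -(mulnA (D ^ 6)%N C2) leq_mul2l; apply/orP; right.
have t1 : (p * (4 * p * (X ^ 2 %/ p ^ 2)) <= 4 * X ^ 2)%N.
  have -> : (p * (4 * p * (X ^ 2 %/ p ^ 2)) = 4 * (X ^ 2 %/ p ^ 2 * p ^ 2))%N by rewrite -mulnn; ring.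
  by rewrite leq_mul2l leq_trunc_div.
have t2 : (p * (4 * p * (X %/ z ^ (3 * l))) <= 4 * 4 ^ L * X ^ 2)%N.
  have Y_gt0 : (0 < z ^ (3 * l))%N by rewrite expn_gt0 z_gt0.
  rewrite -(leq_pmul2r Y_gt0).
  apply: (@leq_trans (4 * (p * p) * X)%N).
    have -> : (p * (4 * p * (X %/ z ^ (3 * l))) * z ^ (3 * l) =
               4 * (p * p) * (X %/ z ^ (3 * l) * z ^ (3 * l)))%N by ring.
    by rewrite leq_mul2l leq_trunc_div orbT.
  apply: (@leq_trans (4 * (4 ^ L * (z ^ (9 * l) * z ^ (3 * l))) * X)%N).
    rewrite leq_mul2r leq_mul2l; apply/orP; right.
    have -> : (4 ^ L * (z ^ (9 * l) * z ^ (3 * l)) = (2 ^ L * z ^ L) * (2 ^ L * z ^ L))%N.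
      rewrite [RHS]mulnACA -(expnMn 2 2 L) -(expnD z (9 * l)) -(expnD z L); congr (_ * _ ^ _)%N.
      by rewrite /L; clear; lia.
    by rewrite leq_mul.
  have : (z ^ (9 * l) <= X)%N by rewrite NX zexp_le // leq_addr.
  clear NX N6 t1; clearbody X; move: (z ^ (9 * l))%N (4 ^ L)%N (z ^ (3 * l))%N => a c b aX.
  have -> : (4 * (c * (a * b)) * X = 4 * c * b * X * a)%N by ring.
  have -> : (4 * c * X ^ 2 * b = 4 * c * b * X * X)%N by rewrite -mulnn; ring.
  by rewrite leq_mul2l aX orbT.
have t3 : (p * (8 * X * z ^ (3 * l)) <= 8 * 2 ^ L * X ^ 2)%N.
  have : (z ^ L * z ^ (3 * l) <= X)%N.
    by rewrite -expnD NX zexp_le // /L; clear; lia.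
  clear NX N6 t1 t2; clearbody X.
  have := p_le; move: (z ^ (3 * l))%N (z ^ L)%N (2 ^ L)%N => a b c pb ba.
  have -> : (p * (8 * X * a) = 8 * X * a * p)%N by ring.
  apply: leq_trans (leq_mul (leqnn _) pb) _.
  have -> : (8 * X * a * (c * b) = 8 * c * X * (b * a))%N by ring.
  have -> : (8 * c * X ^ 2 = 8 * c * X * X)%N by rewrite -mulnn; ring.
  by rewrite leq_mul2l ba orbT.
have c4 : (2 ^ L <= 4 ^ L)%N by apply: leq_exp2r_w.
have c1 : (1 <= 4 ^ L)%N by rewrite expn_gt0.
apply: leq_trans (_ : (4 + 4 * 4 ^ L + 8 * 2 ^ L) * X ^ 2 <= _)%N.
  rewrite 2!mulnDr; apply: leq_trans (leq_add (leq_add t1 t2) t3) _.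
  by apply: eq_leq; ring.
by rewrite /C2 leq_mul2r; apply/orP; right; move: c4 c1; clear; lia.
Qed.

Let sol : finType := (('I_N * 'I_N) * {ffun 'I_m -> T})%type.
Let fq_sol (t : sol) : 'F_p :=
  fq p t.1.1.+1 + fq p t.1.2.+1 + \sum_i fq p (val (val (t.2 i))).

Let E_Y_S (c : 'F_p) :
  \sum_(t : sol) sg t.1.1 * ec p_pr (c * fq_sol t) = Y c * E c * S c ^+ m.
Proof.
have -> : S c ^+ m = \sum_(s : {ffun 'I_m -> T}) ec p_pr (c * \sum_i fq p (val (val (s i)))).
  have := sum_ec_pow p_pr (fun=> 1) (fun t : T => fq p (val (val t))) m c.
  rewrite (eq_bigr (fun t : T => ec p_pr (c * fq p (val (val t))))) => [->|t _]; last by rewrite mul1r.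
  by apply: eq_bigr => s _; rewrite big1 // mul1r.
rewrite /Y /E big_distrlr /= pair_bigA /= big_distrlr /= pair_bigA /=.
by apply: eq_bigr => t _; rewrite /fq_sol !mulrDr !ecD !mulrA.
Qed.

Let rough_card := #|[pred k : 'I_N | ~~ smooth (z ^ u) k.+1]|.

Let sum_sg : \sum_k sg k = N%:R - (2 * rough_card)%:R.
Proof.
rewrite (eq_bigr (fun k : 'I_N => 1 - 2 * (~~ smooth (z ^ u) k.+1)%:R)) => [|k _]; last first.
  by rewrite /sg; case: smooth; rewrite /= ?mulr0 ?subr0 // mulr1 -[RHS]opprK opprB addrK.
rewrite sumrB sumr_const card_ord -mulr_sumr natrM; congr (_ - _ * _).
rewrite /rough_card -sum1_card natr_sum [RHS]big_mkcond /=; apply: eq_bigr => k _.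
by rewrite inE; case: smooth.
Qed.

Let rough2_le : (2 * rough_card <= N)%N.
Proof.
have := roughN; rewrite -/rough_card -/N; move: N_gt0 rough_card; clear => N0 b H.
rewrite leqNgt; apply/negP => lt.
have : (c0 * N <= c0 * (2 * b))%N by rewrite leq_mul2l (ltnW lt) orbT.
by lia.
Qed.

Let main_count := ((N - 2 * rough_card) * N * #|T| ^ m)%N.

Let main_count_ge : (N ^ 2 * z ^ m <= c0 * D ^ m * main_count)%N.
Proof.
have h1 : (N <= c0 * (N - 2 * rough_card))%N.
  by have := roughN; rewrite -/rough_card -/N mulnBr; move: rough_card N; clear; lia.
have h2 : (z ^ m <= D ^ m * #|T| ^ m)%N.
  by rewrite -expnMn leq_exp2r_w // card_sig.
have -> : (c0 * D ^ m * main_count = c0 * (N - 2 * rough_card) * (N * (D ^ m * #|T| ^ m)))%N.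
  by rewrite /main_count; ring.
by rewrite -mulnn -mulnA leq_mul // leq_mul.
Qed.

(** The lengths match: p^10 from the moment of S is at most a constant times z^(10L) = z^(6m), which
    the main term supplies. After cancellation z^6 would be bounded by constants and a power of D
    that is smaller than z. *)
Let main_count_le : ((main_count ^ 6) ^ (2 * r) * z ^ 6 <=
   (32 ^ r * N ^ (2 * r)) ^ 6 * (D ^ 6 * C2 * N ^ 6 * (p ^ 2 * D ^ (2 * L + 2)) ^ 5) ^ (2 * r))%N ->
  False.
Proof.
move=> bound; pose e1 := (6 * m + 16 + 10 * L)%N.
pose W := (N ^ 6 * z ^ (6 * m))%N.
have main6 : (N ^ 6 * W <= (c0 * D ^ m) ^ 6 * main_count ^ 6)%N.
  rewrite -expnMn; apply: leq_trans (leq_exp2r_w 6 main_count_ge).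
  by rewrite (expnMn (N ^ 2)) -(expnM z m) (mulnC m 6) -(expnM N 2) /W mulnA -(expnD N).
have Rle : ((c0 * D ^ m) ^ 6 * (D ^ 6 * C2 * N ^ 6 * (p ^ 2 * D ^ (2 * L + 2)) ^ 5) <=
    C3 * D ^ e1 * W)%N.
  have p10 : (p ^ 10 <= 2 ^ (10 * L) * z ^ (6 * m))%N.
    apply: leq_trans (leq_exp2r_w 10 p_le) _; rewrite expnMn -!expnM (mulnC L 10).
    by rewrite (_ : 10 * L = 6 * m)%N // /m /L; clear; lia.
  have -> : ((c0 * D ^ m) ^ 6 * (D ^ 6 * C2 * N ^ 6 * (p ^ 2 * D ^ (2 * L + 2)) ^ 5) =
     c0 ^ 6 * C2 * D ^ e1 * N ^ 6 * p ^ 10)%N.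
    have -> : (D ^ e1 = D ^ (m * 6) * D ^ 6 * D ^ ((2 * L + 2) * 5))%N.
      by rewrite -!expnD /e1; congr (_ ^ _)%N; clear; lia.
    rewrite !expnMn -!expnM.
    by move: (D ^ (m * 6))%N (D ^ ((2 * L + 2) * 5))%N => x y; ring.
  apply: leq_trans (leq_mul (leqnn _) p10) _; rewrite /C3 /W.
  by move: (2 ^ (10 * L))%N (z ^ (6 * m))%N (D ^ e1)%N => x y w; apply: eq_leq; ring.
have N6_gt0 : (0 < (N ^ 6) ^ (2 * r))%N by rewrite expn_gt0 (expn_gt0 N) N_gt0.
have W_gt0 : (0 < W ^ (2 * r))%N by rewrite expn_gt0 /W muln_gt0 (expn_gt0 N) (expn_gt0 z) N_gt0 z_gt0.
have step : (z ^ 6 <= 32 ^ (r * 6) * (C3 * D ^ e1) ^ (2 * r))%N.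
  rewrite -(leq_pmul2l N6_gt0) -(leq_pmul2l W_gt0).
  apply: (@leq_trans (((c0 * D ^ m) ^ 6) ^ (2 * r) * ((main_count ^ 6) ^ (2 * r) * z ^ 6))).
    rewrite [leqLHS]mulnA [leqRHS]mulnA leq_mul2r; apply/orP; right.
    rewrite -(expnMn W) -(expnMn ((c0 * D ^ m) ^ 6)); apply: leq_exp2r_w.
    by rewrite mulnC.
  apply: leq_trans (leq_mul (leqnn _) bound) _.
  apply: leq_trans (_ : 32 ^ (r * 6) * (N ^ 6) ^ (2 * r) * (C3 * D ^ e1 * W) ^ (2 * r) <= _)%N.
    rewrite mulnCA -expnMn; apply: leq_mul; last exact: leq_exp2r_w.
    by rewrite expnMn -!expnM (mulnC (2 * r)%N 6).
  rewrite (expnMn (C3 * D ^ e1)); apply: eq_leq.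
  by move: (32 ^ (r * 6))%N ((N ^ 6) ^ (2 * r))%N ((C3 * D ^ e1) ^ (2 * r))%N (W ^ (2 * r))%N => x y w t; ring.
have small : (32 ^ (r * 6) * (C3 * D ^ e1) ^ (2 * r) <= D ^ (r * 6 + 2 * r * e1.+1))%N.
  rewrite expnD (mulnC (2 * r)%N) (expnM D e1.+1) leq_mul // leq_exp2r_w //.
    by apply: leq_trans MD; rewrite /M; clear; lia.
  by rewrite expnS leq_mul //; apply: leq_trans MD; rewrite /M; clear; lia.
have eM : (r * 6 + 2 * r * e1.+1 < M)%N by rewrite /M -/e1; clear; lia.
have lt : (D ^ (r * 6 + 2 * r * e1.+1) < z)%N.
  by apply: leq_trans Dz; rewrite ltn_exp2l.
have := leq_trans step small; rewrite leqNgt => /negP; apply; apply: leq_trans lt _.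
by rewrite -{1}(expn1 z) zexp_le.
Qed.

Lemma smooth_solution (x : 'F_p) : exists t : sol,
  [/\ smooth (z ^ u) t.1.1.+1, smooth (z ^ u) t.1.2.+1 & fq_sol t = x].
Proof.
case: (boolP [exists t : sol, [&& smooth (z ^ u) t.1.1.+1, smooth (z ^ u) t.1.2.+1 & fq_sol t == x]]).
  by case/existsP=> t /and3P[s1 s2 /eqP q]; exists t.
rewrite negb_exists => /forallP none; exfalso.
pose V := \sum_(t : sol | fq_sol t == x) sg t.1.1.
(* Symmetrise: sg n1 + sg n2 <= 0 unless n1 and n2 are both smooth. *)
have V_le0 : V <= 0.
  have swap : V = \sum_(t : sol | fq_sol t == x) sg t.1.2.
    pose sw (t : sol) : sol := ((t.1.2, t.1.1), t.2).
    have swK : involutive sw by case=> -[].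
    rewrite /V (reindex_inj (inv_inj swK)) /=; apply: eq_bigl => t.
    by rewrite /fq_sol /= [fq p t.1.2.+1 + _]addrC.
  rewrite -(pmulrn_lle0 V (ltn0Sn 1)) mulr2n {2}swap /V -big_split /=.
  apply: sumr_le0 => t /eqP q; have := none t; rewrite q eqxx andbT /sg.
  by do 2![case: smooth] => //= _; rewrite ?subrr ?addNr // -opprD oppr_le0 addr_ge0 ?ler01.
have total : \sum_c ec p_pr (- (c * x)) * (Y c * E c * S c ^+ m) = p%:R * V.
  rewrite /V -(ec_count p_pr); apply: eq_bigr => c _; congr (_ * _).
  by rewrite -E_Y_S.
have Y0 : Y 0 = (N - 2 * rough_card)%:R.
  by rewrite /Y natrB // -sum_sg; apply: eq_bigr => k _; rewrite mul0r ec0 mulr1.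
have E0 : E 0 = N%:R.
  by rewrite /E (eq_bigr (fun=> 1)) ?sumr_const ?card_ord // => k _; rewrite mul0r.
have S0 : S 0 = #|T|%:R.
  by rewrite /S (eq_bigr (fun=> 1)) ?sumr_const // => k _; rewrite mul0r.
pose bd : algC := (2 * r).-root ((32 ^ r * N ^ (2 * r))%:R / z%:R).
have r2_gt0 : (0 < 2 * r)%N by [].
have z0 : 0 < z%:R :> algC by rewrite ltr0n.
have bd_ge0 : 0 <= bd by rewrite rootC_ge0 // divr_ge0 ?ler0n.
have bdE : bd ^+ (2 * r) = (32 ^ r * N ^ (2 * r))%:R / z%:R by rewrite rootCK.
have E_bd c : c != 0 -> `|E c| <= bd.
  move=> cn0; rewrite -(ler_pXn2r r2_gt0) ?nnegrE ?normr_ge0 //.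
  by rewrite bdE ler_pdivlMr // E_bound.
(* Here m = 5 (2l) and 6 (2l) = 2L, so [holder_pow] with k = 5 yields exactly [Y_moment] and
   [S_moment]. *)
pose X := \sum_c `|Y c| * (`|S c| ^+ (2 * l)) ^+ 5.
have X_ge0 : 0 <= X.
  by apply: sumr_ge0 => c _; rewrite mulr_ge0 ?exprn_ge0.
have main_le : main_count%:R <= bd * X.
  have mainE : main_count%:R = ec p_pr (- (0 * x)) * (Y 0 * E 0 * S 0 ^+ m).
    by rewrite Y0 E0 S0 mul0r oppr0 ec0 mul1r /main_count !natrM natrX.
  move: total; rewrite (bigD1 0) //= -mainE => total.
  set Err := \sum_(_ | _) _ in total.
  have ErrE : main_count%:R - p%:R * V = - Err by rewrite -total opprD addNKr.
  have pV : p%:R * V <= 0 by rewrite pmulr_rle0 // ltr0n prime_gt0.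
  apply: (@le_trans _ _ `|Err|).
    rewrite -normrN -ErrE ger0_norm; first by rewrite lerDl oppr_ge0.
    by rewrite addr_ge0 ?ler0n ?oppr_ge0.
  apply: le_trans (ler_norm_sum _ _ _) _; rewrite /X mulr_sumr.
  rewrite [leRHS](bigD1 0) //= -[leLHS]add0r lerD //.
    by rewrite mulr_ge0 // mulr_ge0 ?exprn_ge0.
  apply: ler_sum => c cn0; rewrite !normrM norm_ec mul1r [`|Y c| * _]mulrC -mulrA.
  rewrite normrX -exprM (_ : 2 * l * 5 = m)%N; last by rewrite /m; clear; lia.
  by rewrite ler_wpM2r ?E_bd // mulr_ge0 ?exprn_ge0.
have X6 : X ^+ 6 <= (D ^ 6 * C2 * N ^ 6 * (p ^ 2 * D ^ (2 * L + 2)) ^ 5)%:R.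
  apply: le_trans (holder_pow 5 (fun c => normr_ge0 (Y c))
    (fun c => exprn_ge0 (2 * l) (normr_ge0 (S c)))) _.
  have S6 : \sum_c (`|S c| ^+ (2 * l)) ^+ 6 <= (p ^ 2 * D ^ (2 * L + 2))%:R.
    apply: le_trans S_moment; rewrite le_eqVlt; apply/orP; left; apply/eqP.
    by apply: eq_bigr => c _; rewrite -exprM; congr (_ ^+ _); rewrite /L; clear; lia.
  have S6_ge0 : 0 <= \sum_c (`|S c| ^+ (2 * l)) ^+ 6.
    by apply: sumr_ge0 => c _; rewrite !exprn_ge0.
  rewrite natrM natrX; apply: ler_pM; rewrite ?exprn_ge0 //.
    by apply: sumr_ge0 => c _; rewrite exprn_ge0.
  by rewrite lerXn2r ?nnegrE ?ler0n.
have main6 : main_count%:R ^+ 6 <= bd ^+ 6 * (D ^ 6 * C2 * N ^ 6 * (p ^ 2 * D ^ (2 * L + 2)) ^ 5)%:R.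
  apply: le_trans (_ : (bd * X) ^+ 6 <= _); first by rewrite lerXn2r ?nnegrE ?mulr_ge0 ?ler0n.
  by rewrite exprMn ler_wpM2l ?exprn_ge0.
apply: main_count_le; rewrite -(ler_nat algC).
set A := (D ^ 6 * C2 * N ^ 6 * _)%N in X6 main6 *.
rewrite natrM [leRHS]natrM; rewrite !(natrX _ (main_count ^ 6)) (natrX _ A) (natrX _ (32 ^ r * N ^ (2 * r))) (natrX _ main_count) (natrX _ z).
have pow : (main_count%:R ^+ 6) ^+ (2 * r) <= (bd ^+ (2 * r)) ^+ 6 * A%:R ^+ (2 * r).
  by rewrite [X in _ <= X * _]exprAC -exprMn lerXn2r ?nnegrE ?exprn_ge0 ?mulr_ge0 ?exprn_ge0 ?ler0n.
apply: le_trans (ler_wpM2r (exprn_ge0 6 (ltW z0)) pow) _.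
by rewrite bdE mulrAC -exprMn divfK ?lt0r_neq0.
Qed.

Lemma nine_small_factors (x : 'F_p) : exists s : seq nat,
  [/\ size s = 9, all (fun y => 0 < y <= z ^ u)%N s & \sum_(y <- s) fq p y = x].
Proof.
have [t [sm1 sm2 tx]] := smooth_solution x.
have U_gt1 : (1 < z ^ u)%N by rewrite -(exp1n u) ltn_exp2r.
have split3 (k : 'I_N) : smooth (z ^ u) k.+1 -> exists x1 x2 x3 : nat,
    (k.+1 = x1 * x2 * x3 /\ (x1 <= z ^ u /\ x2 <= z ^ u /\ x3 <= z ^ u))%N.
  move=> sm; apply: smooth_prod3 => //.
    by rewrite (leq_trans (ltn_ord k)) // -expnM mulnC zexp_le.
  move=> q q_pr q_dvd; apply: (allP sm).
  by rewrite mem_primes q_pr.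
have [x1 [x2 [x3 [xE [le1 [le2 le3]]]]]] := split3 _ sm1.
have [y1 [y2 [y3 [yE [le4 [le5 le6]]]]]] := split3 _ sm2.
pose items := [seq val (val (t.2 i)) : nat | i <- enum 'I_m].
have uE : (z ^ u.-1 * z = z ^ u)%N by rewrite -expnSr prednK.
have items_le : all (fun y => 0 < y <= z)%N items.
  apply/allP => _ /mapP[i _ ->]; apply/andP; split; last by rewrite -ltnS ltn_ord.
  by apply: prime_gt0; apply: (valP (t.2 i)).
have items_prod : (\prod_(y <- items) y <= z ^ m)%N.
  rewrite big_map -[in leqRHS](card_ord m) -prod_nat_const big_enum; apply: leq_prod => i _.
  by rewrite -ltnS ltn_ord.
(* Three factors for each smooth integer and three empty bins; the threshold z^(u-1) leaves room for
   one more prime up to z. *)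
pose b := [:: x1; x2; x3; y1; y2; y3; 1; 1; 1]%N.
have bE : (\prod_(y <- b) y = t.1.1.+1 * t.1.2.+1)%N.
  by rewrite !big_cons big_nil xE yE; ring.
have [|||||s [s9 s_le sE]] := @fill_bins 9 (z ^ u.-1) z b items.
- by [].
- by [].
- have : (0 < x1 * x2 * x3)%N by rewrite -xE.
  have : (0 < y1 * y2 * y3)%N by rewrite -yE.
  rewrite uE !muln_gt0 /= => /andP[/andP[-> ->] ->] /andP[/andP[-> ->] ->].
  by rewrite le1 le2 le3 le4 le5 le6 (ltnW U_gt1).
- exact: items_le.
- rewrite bE -expnM [(_ * 9)%N]mulnC; apply: leq_trans (zexp_le u_cap).
  rewrite expnD leq_mul // mul2n -addnn expnD.
  by apply: leq_mul; apply: ltn_ord.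
exists s; split=> //; first by rewrite -uE.
have cop_le y : (0 < y <= z ^ u)%N -> coprime y p.
  case/andP=> y0 yz; apply: small_coprime => //; rewrite y0 (leq_ltn_trans yz) //.
  by apply: zexp_lt_p; apply: leq_trans un _; rewrite /n /L; move: l_gt0; clear; lia.
rewrite -fq_prod //; last by apply/allP => y /(allP s_le); rewrite uE; apply: cop_le.
have cop_items : all (fun y => coprime y p) items.
  apply/allP => y /(allP items_le)/andP[y0 yz]; apply: cop_le.
  by rewrite y0 (leq_trans yz) // -{1}(expn1 z) zexp_le.
have cop_k (k : 'I_N) : coprime k.+1 p.
  by apply: small_coprime => //=; apply: leq_ltn_trans N_lt_p.
rewrite sE bE !fqM ?coprimeMl ?cop_k ?coprime_prod_all //.
by rewrite -tx /fq_sol fq_prod // big_map big_enum.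
Qed.

End Core.

(** The exponent M depends on l and c0 only, so it can be fixed before p, z and D are chosen. *)
Lemma nine_small_factors_uniform (l c0 : nat) : exists M : nat,
  forall p u z D : nat, prime p -> (0 < l)%N -> (z ^ (6 * l) < p)%N -> (p <= z.+1 ^ (6 * l))%N ->
  (2 * (3 * l + 2) + 10 * l <= 9 * u.-1)%N -> (0 < u)%N -> (u <= 3 * l + 2)%N -> (3 * l + 2 <= 2 * u)%N ->
  (D ^ M <= z)%N -> (M <= D)%N ->
  (forall x : nat, (0 < x <= z ^ (15 * l))%N -> (size (divisors x) <= D)%N) ->
  (z <= D * #|[pred s : 'I_z.+1 | prime s]|)%N ->
  (z ^ (3 * l + 2) + 2 * c0 * #|[pred k : 'I_(z ^ (3 * l + 2)) | ~~ smooth (z ^ u) k.+1]|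
     <= c0 * z ^ (3 * l + 2))%N ->
  forall x : 'F_p, exists s : seq nat,
  [/\ size s = 9, all (fun y => 0 < y <= z ^ u)%N s & \sum_(y <- s) fq p y = x].
Proof.
by eexists=> p u z D; apply: nine_small_factors.
Qed.

Lemma intFp_eqmod (p : nat) (a b : int) : prime p ->
  (a%:~R : 'F_p) = b%:~R -> (a = b %[mod p])%Z.
Proof.
move=> p_pr /eqP; rewrite -subr_eq0 -intrB -(dvdz_pcharf (pchar_Fp p_pr)).
by rewrite -eqz_mod_dvd => /eqP.
Qed.

Theorem corollary3 (R : realType) (eps : R) (eps_gt0 : 0 < eps) :
  exists p0 : nat,
  forall p : nat, prime p -> (p0 <= p)%N ->
  forall U : R, p%:R `^ (2^-1 * expR (- 2^-1) + eps) <= U ->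
  forall a : int, coprimez a p ->
  exists u : 'I_9 -> int,
    (\sum_(i < 9) fermat_quotient p (u i) = a %[mod p])%Z /\
    (forall i : 'I_9, 1 <= u i /\ (u i)%:~R <= U).
Proof.
have [l [u [l_gt0 u_le cap [u_itv nu] s_lt]]] := exponent_choice eps_gt0.
have /andP[u_gt0 un] := u_itv.
have [c0 [z1 rough]] := rough_density u_itv s_lt.
have [M HM] := nine_small_factors_uniform l c0.
have [z2 sub] := subpoly_param R M (15 * l).
have L_gt0 : (0 < 6 * l)%N by rewrite muln_gt0.
exists ((z1 + z2 + 2) ^ (6 * l))%N => p p_pr p_ge U U_ge a _.
have [z /andP[zp pz]] := floor_root p L_gt0.
have z_ge : (z1 + z2 + 2 <= z)%N.
  by rewrite -ltnS -(ltn_exp2r _ _ L_gt0); apply: leq_ltn_trans pz.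
have z_gt1 : (1 < z)%N by apply: leq_trans z_ge; rewrite leq_addl.
(* Strict, as a prime is no proper power of z > 1. *)
have zp' : (z ^ (6 * l) < p)%N.
  rewrite ltn_neqAle zp andbT; apply/eqP => E.
  have : (z %| p)%N by rewrite -E -(prednK L_gt0) expnS dvdn_mulr.
  case/primeP: p_pr => _ /[apply]; rewrite (gtn_eqF z_gt1) /= => /eqP zE.
  have : (z ^ 1 < z ^ (6 * l))%N by rewrite ltn_exp2l //; case: (l) l_gt0 => // l'; rewrite mulnS.
  by rewrite expn1 E zE ltnn.
have z1_le : (z1 <= z)%N by apply: leq_trans z_ge; rewrite -addnA leq_addr.
have z2_le : (z2 <= z)%N by apply: leq_trans z_ge; rewrite -addnA addnCA leq_addr.
have [D [Dz MD tauD piD]] := sub z z2_le.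
have rough_z := rough z z1_le.
have [s [s9 s_le s_sum]] := HM p u z D p_pr l_gt0 zp' (ltnW pz) cap u_gt0 un nu Dz MD tauD piD rough_z a%:~R.
exists (fun i => (nth 0%N s i)%:Z); split.
  apply: intFp_eqmod => //; rewrite rmorph_sum /= -s_sum.
  by rewrite (big_nth 0%N) s9 big_mkord.
move=> i; have /(allP s_le)/andP[y_gt0 y_le] : nth 0%N s i \in s by rewrite mem_nth ?s9.
split; first by rewrite lez_nat.
apply: le_trans U_ge; rewrite -[_%:~R]/(_%:R : R).
apply: (@le_trans _ _ (z ^ u)%:R); first by rewrite ler_nat.
have z0 : 0 < z%:R :> R by rewrite ltr0n ltnW.
have p0 : 0 < p%:R :> R by rewrite ltr0n prime_gt0.
rewrite -ler_ln ?posrE ?powR_gt0 ?ltr0n ?expn_gt0 ?(ltnW z_gt1) ?prime_gt0 //.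
rewrite ln_powR natrX lnXn // -[leLHS]mulr_natl.
have lnz_ge0 : 0 <= ln z%:R :> R by apply: ln_nat_ge0.
(* In logarithms: u is at most 6l times the exponent of the theorem, and z^(6l) <= p. *)
apply: le_trans (ler_wpM2r lnz_ge0 u_le) _; rewrite -mulrA; apply: ler_wpM2l.
  by rewrite addr_ge0 ?(ltW eps_gt0) // mulr_ge0 ?invr_ge0 ?expR_ge0.
rewrite mulr_natl -lnXn // -natrX ler_ln ?posrE ?ltr0n ?expn_gt0 ?(ltnW z_gt1) ?prime_gt0 //.
by rewrite ler_nat.
Qed.
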